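(* Let $A$ be a Nakayama algebra. Then $$\operatorname{fin-pro} A=\max_S e(S),$$ where $S$ runs through the simple $A$-modules and $e(S)=\min\{\operatorname{pd} S,\operatorname{pd} IS\}$.
   Context: A Nakayama algebra is an artin algebra such that all indecomposable modules are serial (i.e. have a unique composition series). Modules are left $A$-modules; $\operatorname{pd}$ denotes projective dimension (possibly $\infty$); $IS$ is an injective envelope of $S$. $\operatorname{fin-pro} A$ is the supremum of $\operatorname{pd} M$ over the finitely generated modules $M$ of finite projective dimension. *)

(* Defs.v *)
From HB Require Import structures.
From mathcomp Require Import all_boot all_algebra.
From mathcomp Require Import boolp.
Set Implicit Arguments.
Unset Strict Implicit.
Unset Printing Implicit Defensive.
Import GRing.Theory.
Local Open Scope ring_scope.

(* Extended natural numbers: [None] stands for infinity. *)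
Definition enat := option nat.

Definition enat_le (x y : enat) : bool :=
  match x, y with
  | _, None => true
  | None, Some _ => false
  | Some m, Some n => (m <= n)%N
  end.

Definition enat_min (x y : enat) : enat := if enat_le x y then x else y.

Definition is_max (P : enat -> Prop) (d : enat) : Prop :=
  P d /\ forall v, P v -> enat_le v d.

(* The least natural number satisfying [P], infinity if there is none. *)
Definition enat_least (P : nat -> Prop) : enat :=
  if pselect (exists n, `[< P n >]) is left exP then Some (ex_minn exP)
  else None.

(* The supremum of [P], as its least finite upper bound, if any.  It is 0 for
   an empty [P]. *)
Definition enat_sup (P : enat -> Prop) : enat :=
  enat_least (fun n => forall v, P v -> enat_le v (Some n)).

Section Modules.
Variable R : pzRingType.
Implicit Types M : lmodType R.

(* Submodules of [M] are the [U : {pred M}] such that [submod_closed U]; as the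
   underlying logic is classical, boolean predicates capture all subsets. *)

Definition zero_module M : Prop := forall x : M, x = 0.

Definition finitely_generated M : Prop :=
  exists (n : nat) (g : 'I_n -> M),
    forall x : M, exists c : 'I_n -> R, x = \sum_(i < n) c i *: g i.

Definition artinian M : Prop :=
  forall U : nat -> {pred M},
    (forall n, submod_closed (U n)) ->
    (forall n, {subset U n.+1 <= U n}) ->
    exists m : nat, forall n, (m <= n)%N -> U n =i U m.

Definition simple_module M : Prop :=
  ~ zero_module M /\
  forall U : {pred M}, submod_closed U -> U =i pred1 0 \/ U =i predT.

Definition indecomposable M : Prop :=
  ~ zero_module M /\
  forall U V : {pred M}, submod_closed U -> submod_closed V ->
    (forall x, x \in U -> x \in V -> x = 0) ->
    (forall x, exists u v, [/\ u \in U, v \in V & x = u + v]) ->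
    U =i pred1 0 \/ V =i pred1 0.

(* [U 0, ..., U n] is a composition series of length [n] of [M], written as a
   maximal chain: strict inclusions admitting no intermediate submodule.
   Values of [U] beyond [n] are irrelevant. *)
Definition composition_series M (n : nat) (U : nat -> {pred M}) : Prop :=
  [/\ U 0%N =i pred1 0,
      U n =i predT,
      forall i, (i <= n)%N -> submod_closed (U i) &
      forall i, (i < n)%N ->
        [/\ {subset U i <= U i.+1},
            ~ (U i =i U i.+1) &
            forall V : {pred M}, submod_closed V ->
              {subset U i <= V} -> {subset V <= U i.+1} ->
              V =i U i \/ V =i U i.+1]].

Definition serial M : Prop :=
  (exists n U, @composition_series M n U) /\
  forall m n U V, @composition_series M m U -> @composition_series M n V ->
    m = n /\ forall i, (i <= n)%N -> U i =i V i.

Definition surjective_map (X Y : Type) (f : X -> Y) : Prop :=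
  forall y, exists x, f x = y.

Definition projective (P : lmodType R) : Prop :=
  forall (M N : lmodType R) (g : {linear M -> N}) (f : {linear P -> N}),
    surjective_map g -> exists h : {linear P -> M}, forall x, g (h x) = f x.

Definition injective_module (Q : lmodType R) : Prop :=
  forall (M N : lmodType R) (g : {linear M -> N}) (f : {linear M -> Q}),
    injective g -> exists h : {linear N -> Q}, forall x, h (g x) = f x.

Definition exact_at (M N P : lmodType R)
    (f : {linear M -> N}) (g : {linear N -> P}) : Prop :=
  forall y : N, g y = 0 <-> exists x, f x = y.

(* 0 -> P n -> ... -> P 1 -> P 0 -> M -> 0 *)
Definition projective_resolution M (n : nat) (P : nat -> lmodType R)
    (d : forall i, {linear P i.+1 -> P i}) (eps : {linear P 0%N -> M}) : Prop :=
  [/\ forall i, projective (P i),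
      forall i, (n < i)%N -> zero_module (P i),
      surjective_map eps,
      exact_at (d 0%N) eps &
      forall i, exact_at (d i.+1) (d i)].

Definition pd M : enat :=
  enat_least (fun n => exists P d eps, @projective_resolution M n P d eps).

(* An injective envelope of [S]: an essential embedding into an injective. *)
Definition injective_envelope (S I : lmodType R) (i : {linear S -> I}) : Prop :=
  [/\ injective_module I,
      injective i &
      forall U : {pred I}, submod_closed U -> ~ (U =i pred1 0) ->
        exists2 x : S, x <> 0 & i x \in U].

End Modules.

Definition fin_pro (R : pzRingType) : enat :=
  enat_sup (fun v => exists M : lmodType R,
    [/\ finitely_generated M, pd M <> None & v = pd M]).

Definition artin_algebra (k : comNzRingType) (A : algType k) : Prop :=
  @artinian k k^o /\ @finitely_generated k A.

(* Modules over an artin algebra are understood to be finitely generated in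
   this definition; this is the weakest form of the condition. *)
Definition nakayama_algebra (k : comNzRingType) (A : algType k) : Prop :=
  artin_algebra A /\
  forall M : lmodType A, finitely_generated M -> indecomposable M -> serial M.

(* The values e(S), [S] simple.  Injective envelopes are unique up to
   isomorphism, so [v] depends only on [S]. *)
Definition e_value (R : pzRingType) (S : lmodType R) (v : enat) : Prop :=
  exists (I : lmodType R) (i : {linear S -> I}),
    injective_envelope i /\ v = enat_min (pd S) (pd I).

(* Main.v *)
Require Import Defs.
From HB Require Import structures.
From mathcomp Require Import all_boot all_algebra.
From mathcomp Require Import boolp.
From mathcomp Require classical_sets.
Set Implicit Arguments.
Unset Strict Implicit.
Unset Printing Implicit Defensive.
Import GRing.Theory.
Local Open Scope ring_scope.

(** Let [m] be the finitistic dimension of the Nakayama algebra [A].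

    There are finitely many indecomposable modules up to isomorphism: each is
    uniserial, hence a quotient of one of the uniserial summands of the regular
    module.  So [m] is finite and is the projective dimension of some nonzero
    uniserial module [M] ([fpd_bound], [fin_pro_attained]).

    Choose such an [M] of least length, let [S] be its socle and [I] the
    injective envelope of [S], so that [M] embeds in [I].  If [pd S < m], then
    [M / S] is nonzero and again has projective dimension [m], but it is
    shorter.  If [pd I < m], then [pd (I / M) = m + 1], against the choice of
    [m].  Hence [e(S) >= m] ([simple_attains]).

    What remains, both for [e(S) = m] and for [e(S') <= m] in general, is that
    a simple module and its injective envelope never both have infinite
    projective dimension ([simple_or_hull_fpd]).  Draw an arrow from [S] to
    every composition factor [T] of its second syzygy [K], the kernel of
    [P1 -> P0] in the minimal presentation [P1 -> P0 -> S -> 0].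
    - The injective envelope of such a [T] is a quotient of [P1]
      ([syzygy_hull]).  Its top is therefore the top of [rad P0], which
      determines [S]: at most one arrow ends in [T] ([arrow_indegree]).
    - If [pd S] is infinite, then some arrow from [S] ends in a simple module of
      infinite projective dimension ([arrow_exists]).
    As there are finitely many simple modules, counting ([indegree_count])
    shows that among those of infinite projective dimension exactly one arrow
    ends in, and exactly one starts from, each of them.  Let [S] be one of
    them, reached from [S'] with presentation [P1 -> P0 -> S' -> 0]; then its
    envelope is [I = P1 / V] with [V] inside [K].  If [pd I] were infinite, so
    would be [pd V], and [V] would have a composition factor of infinite
    projective dimension.  This factor can only be [S]; so [I] would also be
    [P1 / V2] with [V2] strictly smaller than [V], contradicting the lengths.

    Modules are arbitrary in the definitions of projective dimension and of
    injectivity.  Dimensions are compared across resolutions by a form of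
    Schanuel's lemma ([kernel_retract]), and injectivity of the longest
    uniserial module with a given socle comes from Baer's criterion
    ([simple_hull], [baer_criterion]). *)

(** * Submodules and quotient modules *)

Section Submodules.
Variable R : pzRingType.

Definition mklin (M N : lmodType R) (f : M -> N) (fL : linear f) :
    {linear M -> N} :=
  HB.pack f (GRing.isLinear.Build R M N *:%R f fL).

(** Submodules are bundled, and are equal as soon as they have the same
    elements ([submod_ext]), so that they can be rewritten and chosen. *)
Record submod (M : lmodType R) :=
  Submod { smem :> {pred M}; submodP : submod_closed smem }.

HB.instance Definition _ (M : lmodType R) (U : submod M) :=
  GRing.isSubmodClosed.Build R M (smem U)
    (GRing.submod_closed_semi (submodP U)).

Record smod (M : lmodType R) (U : submod M) :=
  Smod { mval : M; mvalP : mval \in smem U }.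

HB.instance Definition _ (M : lmodType R) (U : submod M) :=
  [isSub of smod U for @mval M U].
HB.instance Definition _ (M : lmodType R) (U : submod M) :=
  [Choice of smod U by <:].
HB.instance Definition _ (M : lmodType R) (U : submod M) :=
  [SubChoice_isSubLmodule of smod U by <:].

Lemma mval_is_linear (M : lmodType R) (U : submod M) : linear (@mval M U).
Proof. by move=> a x y; rewrite -[mval _]/(\val _) linearP. Qed.
HB.instance Definition _ (M : lmodType R) (U : submod M) :=
   GRing.isLinear.Build R (smod U) M *:%R (@mval M U) (@mval_is_linear M U).

Definition incl (M : lmodType R) (U : submod M) : {linear smod U -> M} :=
  @mval M U.

Lemma smod_ext (M : lmodType R) (U : submod M) (x y : smod U) :
  mval x = mval y -> x = y.
Proof. exact: val_inj. Qed.

Lemma submod_ext (M : lmodType R) (U V : submod M) :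
  smem U =i smem V -> U = V.
Proof.
case: U V => [U HU] [V HV] /= e.
have {e} e : U = V by apply/funext => x; have := e x; rewrite !unfold_in.
by move: HV; rewrite -e => HV; rewrite (Prop_irrelevance HU HV).
Qed.

Lemma prop_submod_closed (M : lmodType R) (P : M -> Prop) :
  P 0 -> (forall a x y, P x -> P y -> P (a *: x + y)) ->
  submod_closed ((fun x => `[< P x >]) : {pred M}).
Proof.
move=> P0 PD; split; first exact/asboolP.
by move=> a x y /asboolP Px /asboolP Py; apply/asboolP/PD.
Qed.

Definition psub (M : lmodType R) (P : M -> Prop) (P0 : P 0)
   (PD : forall a x y, P x -> P y -> P (a *: x + y)) : submod M :=
  Submod (prop_submod_closed P0 PD).

Lemma psubP (M : lmodType R) (P : M -> Prop) P0 PD x :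
  reflect (P x) (x \in smem (@psub M P P0 PD)).
Proof. exact: asboolP. Qed.

(** The quotient by [U] consists of the representatives chosen, one in each
    class, by the choice operator of [M]; it is thus a subtype of [M]. *)
Section Quotient.
Variables (M : lmodType R) (U : submod M).

Definition qcanon (x : M) : M := choose (fun y => x - y \in smem U) x.

Lemma qcanonP x : x - qcanon x \in smem U.
Proof. by apply: (@chooseP _ (fun y => x - y \in smem U)); rewrite subrr rpred0. Qed.

Lemma qcanon_eq x y : x - y \in smem U -> qcanon x = qcanon y.
Proof.
move=> xy; rewrite /qcanon.
have e : (fun z => x - z \in smem U) =1 (fun z => y - z \in smem U).
  move=> z /=; apply/idP/idP => h.
    have -> : y - z = (x - z) - (x - y) by rewrite opprB [RHS]addrC addrA subrK.
    exact: rpredB.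
  have -> : x - z = (x - y) + (y - z) by rewrite addrA subrK.
  exact: rpredD.
rewrite (eq_choose e); apply: choose_id => //; last by rewrite subrr rpred0.
by rewrite -opprB rpredN.
Qed.

Record qmod := Qmod { qrep : M; qrepP : qcanon qrep == qrep }.
HB.instance Definition _ := [isSub of qmod for qrep].
HB.instance Definition _ := [Choice of qmod by <:].

Lemma qcanonK x : qcanon (qcanon x) == qcanon x.
Proof. by apply/eqP/qcanon_eq; rewrite -opprB rpredN qcanonP. Qed.

Definition qclass (x : M) : qmod := Qmod (qcanonK x).

Lemma qproj_eq x y : x - y \in smem U -> qclass x = qclass y.
Proof. by move=> h; apply: val_inj; apply: qcanon_eq. Qed.

Lemma qrepK (x : qmod) : qclass (qrep x) = x.
Proof. by apply: val_inj => /=; apply/eqP/qrepP. Qed.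

Lemma qprojK x : x - qrep (qclass x) \in smem U.
Proof. exact: qcanonP. Qed.

Lemma qrep_ex (P : qmod -> Prop) : (forall x, P (qclass x)) -> forall x, P x.
Proof. by move=> h x; rewrite -(qrepK x). Qed.

Definition qadd (x y : qmod) := qclass (qrep x + qrep y).
Definition qopp (x : qmod) := qclass (- qrep x).
Definition qscale (a : R) (x : qmod) := qclass (a *: qrep x).

Lemma qaddE x y : qadd (qclass x) (qclass y) = qclass (x + y).
Proof.
apply: qproj_eq; rewrite -opprB rpredN opprD addrACA.
by rewrite rpredD ?qprojK.
Qed.
Lemma qoppE x : qopp (qclass x) = qclass (- x).
Proof. by apply: qproj_eq; rewrite opprK addrC qprojK. Qed.
Lemma qscaleE a x : qscale a (qclass x) = qclass (a *: x).
Proof.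
by apply: qproj_eq; rewrite -opprB rpredN -scalerBr rpredZ // qprojK.
Qed.

Fact qaddA : associative qadd.
Proof.
by elim/qrep_ex => x; elim/qrep_ex => y; elim/qrep_ex => z; rewrite !qaddE addrA.
Qed.
Fact qaddC : commutative qadd.
Proof. by elim/qrep_ex => x; elim/qrep_ex => y; rewrite !qaddE addrC. Qed.
Fact qadd0 : left_id (qclass 0) qadd.
Proof. by elim/qrep_ex => x; rewrite qaddE add0r. Qed.
Fact qaddN : left_inverse (qclass 0) qopp qadd.
Proof. by elim/qrep_ex => x; rewrite qoppE qaddE addNr. Qed.
HB.instance Definition _ := GRing.isZmodule.Build qmod qaddA qaddC qadd0 qaddN.

Lemma qaddRE x y : qclass x + qclass y = qclass (x + y).
Proof. exact: qaddE. Qed.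

Fact qscaleA a b v : qscale a (qscale b v) = qscale (a * b) v.
Proof. by elim/qrep_ex: v => v; rewrite !qscaleE scalerA. Qed.
Fact qscale1 : left_id 1 qscale.
Proof. by elim/qrep_ex => v; rewrite qscaleE scale1r. Qed.
Fact qscaleDr : right_distributive qscale +%R.
Proof.
move=> a; elim/qrep_ex => x; elim/qrep_ex => y.
by rewrite !(qscaleE, qaddRE) scalerDr.
Qed.
Fact qscaleDl v : {morph qscale^~ v : a b / a + b}.
Proof. by move=> a b; elim/qrep_ex: v => v; rewrite !(qscaleE, qaddRE) scalerDl. Qed.
HB.instance Definition _ :=
  GRing.Zmodule_isLmodule.Build R qmod qscaleA qscale1 qscaleDr qscaleDl.

Fact qproj_linear : linear qclass.
Proof. by move=> a x y; rewrite -[_ + _ in RHS]/(qadd _ _) -[_ *: _ in RHS]/(qscale _ _) qscaleE qaddE. Qed.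

Definition qproj : {linear M -> qmod} := mklin qproj_linear.

Lemma qproj_surj (y : qmod) : exists x, qproj x = y.
Proof. by exists (qrep y); apply: qrepK. Qed.

Lemma qproj_ker x : (qproj x == 0) = (x \in smem U).
Proof.
apply/eqP/idP => [|h]; last by apply: qproj_eq; rewrite subr0.
move=> e; have := qprojK x; rewrite -[qclass x]/(qproj x) e => h.
have h0 := qprojK 0; rewrite sub0r rpredN in h0.
by rewrite -(subrK (qrep (0 : qmod)) x) rpredD.
Qed.
End Quotient.

End Submodules.

(** * Linear maps *)
Section LinearMaps.
Variable R : pzRingType.
Implicit Types M N P X Y Z K : lmodType R.

Fact lid_linear M : linear (fun x : M => x).
Proof. by []. Qed.
Definition lid M := mklin (@lid_linear M).

Fact lzero_linear M N : linear (fun _ : M => 0 : N).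
Proof. by move=> a x y; rewrite scaler0 addr0. Qed.
Definition lzero M N := mklin (@lzero_linear M N).

Fact lcomp_linear M N P (g : {linear N -> P}) (f : {linear M -> N}) :
  linear (fun x => g (f x)).
Proof. by move=> a x y; rewrite !linearP. Qed.
Definition lcomp M N P (g : {linear N -> P}) (f : {linear M -> N}) :=
  mklin (lcomp_linear g f).

Fact ladd_linear M N (g f : {linear M -> N}) :
  linear (fun x => g x + f x).
Proof. by move=> a x y; rewrite !linearP scalerDr addrACA. Qed.
Definition ladd M N (g f : {linear M -> N}) := mklin (ladd_linear g f).

Fact lopp_linear M N (f : {linear M -> N}) : linear (fun x => - f x).
Proof. by move=> a x y; rewrite !linearP. Qed.
Definition lopp M N (f : {linear M -> N}) := mklin (lopp_linear f).

Fact lfst_linear M N : linear (fun z : (M * N)%type => z.1).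
Proof. by []. Qed.
Definition lfst M N : {linear (M * N)%type -> M} := mklin (@lfst_linear M N).
Fact lsnd_linear M N : linear (fun z : (M * N)%type => z.2).
Proof. by []. Qed.
Definition lsnd M N : {linear (M * N)%type -> N} := mklin (@lsnd_linear M N).
Fact lpair_linear P M N (f : {linear P -> M}) (g : {linear P -> N}) :
  linear (fun x => (f x, g x) : (M * N)%type).
Proof. by move=> a x y; rewrite !linearP. Qed.
Definition lpair P M N (f : {linear P -> M}) (g : {linear P -> N}) :
  {linear P -> (M * N)%type} := mklin (lpair_linear f g).

(** Most linear maps below are obtained from their graphs: a total linear
    relation [G] in which only [0] is related to [0] is a linear map. *)
Lemma linear_of_relation M N (G : M -> N -> Prop) :
  (forall x, exists y, G x y) ->
  (forall y, G 0 y -> y = 0) ->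
  (forall a x x' y y', G x y -> G x' y' -> G (a *: x + x') (a *: y + y')) ->
  exists h : {linear M -> N}, forall x, G x (h x).
Proof.
move=> Gex G0 GD; have [h hP] := choice Gex.
have Gu x y y' : G x y -> G x y' -> y = y'.
  move=> Gy Gy'; apply/eqP; rewrite -subr_eq0; apply/eqP.
  by apply: G0; have := GD (-1) x x y' y Gy' Gy; rewrite !scaleN1r !addNr addrC.
have hL : linear h by move=> a x y; apply: (Gu _ _ _ (hP _)); apply: GD; apply: hP.
by exists (mklin hL).
Qed.

Lemma lin_inj M N (f : {linear M -> N}) :
  injective f <-> (forall x, f x = 0 -> x = 0).
Proof.
split=> [fI x fx0|h x y fxy]; first by apply: fI; rewrite fx0 linear0.
by apply/eqP; rewrite -subr_eq0; apply/eqP/h; rewrite linearB fxy subrr.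
Qed.

Lemma factor_inj M N P (i : {linear M -> N}) (h : {linear P -> N}) :
  injective i -> (forall x, exists y, i y = h x) ->
  exists h' : {linear P -> M}, forall x, i (h' x) = h x.
Proof.
move=> iI ih; apply: (linear_of_relation (G := fun x y => i y = h x)) => //.
  by move=> y; rewrite linear0 => iy0; apply: iI; rewrite linear0.
by move=> a x x' y y' e e'; rewrite !linearP e e'.
Qed.

Lemma factor_surj M N P (g : {linear M -> N}) (h : {linear M -> P}) :
  surjective_map g -> (forall x, g x = 0 -> h x = 0) ->
  exists h' : {linear N -> P}, forall x, h' (g x) = h x.
Proof.
move=> gS gh.
have [|||h' h'P] := @linear_of_relation N P (fun y z => exists2 x, g x = y & h x = z).
- by move=> y; have [x <-] := gS y; exists (h x), x.
- by move=> z [x gx0 <-]; apply: gh.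
- move=> a x x' y y' [u <- <-] [v <- <-]; exists (a *: u + v).
    by rewrite linearP.
  by rewrite linearP.
exists h' => x; have [u gu <-] := h'P (g x).
apply/eqP; rewrite -subr_eq0 -linearB; apply/eqP/gh.
by rewrite linearB gu subrr.
Qed.

Definition subzero M : submod M.
apply: (@psub _ _ (fun x : M => x = 0)) => //.
by move=> a x y -> ->; rewrite scaler0 addr0.
Defined.
Definition subfull M : submod M := @psub _ _ (fun x : M => True) I (fun _ _ _ _ _ => I).
Definition kersub M N (f : {linear M -> N}) : submod M.
apply: (@psub _ _ (fun x : M => f x = 0)) => [|a x y fx fy]; first by rewrite linear0.
by rewrite linearP fx fy scaler0 addr0.
Defined.
Definition imsub M N (f : {linear M -> N}) (U : submod M) : submod N.
apply: (@psub _ _ (fun y => exists2 x, x \in smem U & f x = y)).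
  by exists 0; rewrite ?linear0 ?rpred0.
move=> a _ _ [x xU <-] [y yU <-]; exists (a *: x + y); last by rewrite linearP.
by rewrite rpredD ?rpredZ.
Defined.
Definition presub M N (f : {linear M -> N}) (U : submod N) : submod M.
apply: (@psub _ _ (fun x => f x \in smem U)); first by rewrite linear0 rpred0.
by move=> a x y xU yU; rewrite linearP rpredD ?rpredZ.
Defined.
Definition subcap M (U V : submod M) : submod M.
apply: (@psub _ _ (fun x => x \in smem U /\ x \in smem V)); first by rewrite !rpred0.
by move=> a x y [xU xV] [yU yV]; rewrite !rpredD ?rpredZ.
Defined.
Definition subsum M (U V : submod M) : submod M.
apply: (@psub _ _ (fun x => exists u v, [/\ u \in smem U, v \in smem V & x = u + v])).
  by exists 0, 0; rewrite !rpred0 addr0.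
move=> a _ _ [u [v [uU vV ->]]] [u' [v' [uU' vV' ->]]].
exists (a *: u + u'), (a *: v + v'); rewrite !rpredD ?rpredZ //.
by rewrite scalerDr addrACA.
Defined.

Definition sle M (U V : submod M) := {subset smem U <= smem V}.

Lemma sle_refl M (U : submod M) : sle U U. Proof. by []. Qed.
Lemma sle_trans M (U V W : submod M) : sle U V -> sle V W -> sle U W.
Proof. by move=> h k x /h /k. Qed.
Lemma sle_anti M (U V : submod M) : sle U V -> sle V U -> U = V.
Proof. by move=> h k; apply: submod_ext => x; apply/idP/idP; [apply: h|apply: k]. Qed.
Lemma sub0le M (U : submod M) : sle (subzero M) U.
Proof. by move=> x /psubP ->; rewrite rpred0. Qed.
Lemma subfullP M x : x \in smem (subfull M).
Proof. exact/psubP. Qed.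
Lemma lefull M (U : submod M) : sle U (subfull M).
Proof. by move=> x _; apply: subfullP. Qed.

Lemma mem_kersub M N (f : {linear M -> N}) x : x \in smem (kersub f) <-> f x = 0.
Proof. by split => [/psubP|h]; last apply/psubP. Qed.
Lemma mem_im M N (f : {linear M -> N}) (U : submod M) x :
  x \in smem U -> f x \in smem (imsub f U).
Proof. by move=> xU; apply/psubP; exists x. Qed.

End LinearMaps.

(** * Projective dimension *)
Section Homological.
Variable R : pzRingType.
Implicit Types M N P X Y Z K L Q : lmodType R.

Definition ses X Y Z (f : {linear X -> Y}) (g : {linear Y -> Z}) :=
  [/\ injective f, surjective_map g & exact_at f g].

Definition retract X Y := exists (s : {linear X -> Y}) (r : {linear Y -> X}),
  forall x, r (s x) = x.

Definition iso X Y := exists (f : {linear X -> Y}) (g : {linear Y -> X}),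
  (forall x, g (f x) = x) /\ (forall y, f (g y) = y).

Lemma bij_iso X Y (f : {linear X -> Y}) : injective f -> surjective_map f -> iso X Y.
Proof.
move=> fI fS; have [g gP] := factor_inj (h := lid Y) fI fS.
exists f, g; split => [x|y]; last by rewrite gP.
by apply: fI; rewrite gP.
Qed.

Lemma iso_retract X Y : iso X Y -> retract X Y.
Proof. by case=> f [g [fg gf]]; exists f, g. Qed.
Lemma iso_sym X Y : iso X Y -> iso Y X.
Proof. by case=> f [g [fg gf]]; exists g, f. Qed.
Lemma iso_trans X Y Z : iso X Y -> iso Y Z -> iso X Z.
Proof.
case=> f [g [fg gf]] [f' [g' [fg' gf']]]; exists (lcomp f' f), (lcomp g g').
by split=> x /=; rewrite ?fg' ?fg ?gf ?gf'.
Qed.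
Lemma ses_ker X Y (g : {linear X -> Y}) : surjective_map g -> ses (incl (kersub g)) g.
Proof.
move=> gS; split=> //; first exact: smod_ext.
move=> y; split => [gy|[x <-]]; last exact/mem_kersub/mvalP.
by exists (Smod ((mem_kersub g y).2 gy)).
Qed.

Lemma ses_quo M (U : submod M) : ses (incl U) (qproj U).
Proof.
split; [exact: smod_ext|exact: qproj_surj|move=> x; split].
  by move/eqP; rewrite qproj_ker => xU; exists (Smod xU).
by case=> y <-; apply/eqP; rewrite qproj_ker mvalP.
Qed.

Lemma ses_prod X Y : ses (lpair (lid X) (lzero X Y)) (lsnd X Y).
Proof.
split; first by move=> x y [].
  by move=> y; exists (0, y).
by move=> [x y]; split => [/= ->|[z [_ <-]]] //; exists x.
Qed.

Lemma retract_projective X Y : retract X Y -> projective Y -> projective X.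
Proof.
case=> s [r rs] YP M N g f gS.
have [h hP] := YP M N g (lcomp f r) gS.
by exists (lcomp h s) => x /=; rewrite hP /= rs.
Qed.

Lemma prod_projective X Y : projective X -> projective Y -> projective (X * Y)%type.
Proof.
move=> XP YP M N g f gS.
have [h hP] := XP M N g (lcomp f (lpair (lid X) (lzero X Y))) gS.
have [k kP] := YP M N g (lcomp f (lpair (lzero Y X) (lid Y))) gS.
exists (ladd (lcomp h (lfst X Y)) (lcomp k (lsnd X Y))) => -[x y] /=.
rewrite linearD hP kP /= -linearD.
by have -> : ((x, 0) + (0, y) : (X * Y)%type) = (x, y) by congr pair; rewrite ?addr0 ?add0r.
Qed.

Lemma ses_split X Y Z (f : {linear X -> Y}) (g : {linear Y -> Z}) :
  ses f g -> projective Z -> retract Y (X * Z)%type.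
Proof.
move=> [fI gS ex] ZP; have [s sP] := ZP _ _ g (lid Z) gS.
have [t tP] : exists t : {linear Y -> X}, forall y, f (t y) = y - s (g y).
  apply: (factor_inj (h := ladd (lid Y) (lopp (lcomp s g))) fI) => y.
  by apply/ex; rewrite /= linearB sP subrr.
exists (lpair t g), (ladd (lcomp f (lfst X Z)) (lcomp s (lsnd X Z))) => y /=.
by rewrite tP subrK.
Qed.

Lemma ses_projective X Y Z (f : {linear X -> Y}) (g : {linear Y -> Z}) :
  ses f g -> projective X -> projective Z -> projective Y.
Proof.
move=> h XP ZP; apply: retract_projective (ses_split h ZP) _.
exact: prod_projective.
Qed.

(** [pd M <= n] by recursion on syzygies; see [pd_leP] for the equivalence with
    the definition by resolutions. *)
Fixpoint pdle (n : nat) (M : lmodType R) : Prop :=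
  if n is n'.+1 then
    exists (K P : lmodType R) (i : {linear K -> P}) (g : {linear P -> M}),
      [/\ projective P, ses i g & pdle n' K]
  else projective M.

Lemma pdle_stab n K P : pdle n K -> projective P -> pdle n (K * P)%type.
Proof.
case: n => [|n] /=; first exact: prod_projective.
move=> [K' [P' [i [g [P'P [iI gS ex] K'n]]]]] PP.
exists K', (P' * P)%type, (lpair i (lzero K' P)),
  (lpair (lcomp g (lfst P' P)) (lsnd P' P)); split => //.
  exact: prod_projective.
split.
- by move=> x y [/iI].
- by move=> [x y]; have [u <-] := gS x; exists (u, y).
move=> [x y]; split => /= [[/ex[u <-] ->]|[u [<- <-]]]; first by exists u.
by congr pair; apply/ex; exists u.
Qed.

(** Schanuel's lemma for a retract [X] of [Y].  Let [a : P -> P'] and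
    [b : P' -> P] lift the section and the retraction.  Then [q \o b \o a = q], so
    [1 - b \o a] maps [P] to [K], and [x = b (a x) + (x - b (a x))] factors the
    identity of [K] through [K' * P].  With [X = Y] it compares two syzygies of
    the same module; with [X] a summand it yields [retract_pdle]. *)
Lemma kernel_retract X Y K P K' P' (i : {linear K -> P}) (q : {linear P -> X})
    (i' : {linear K' -> P'}) (g : {linear P' -> Y}) :
  ses i q -> ses i' g -> projective P -> projective P' -> retract X Y ->
  retract K (K' * P)%type.
Proof.
move=> [iI qS ex] [i'I gS ex'] PP P'P [s [r rs]].
have [a aP] := PP _ _ g (lcomp s q) gS.
have [b bP] := P'P _ _ q (lcomp r g) qS.
have [u uP] : exists u : {linear K -> K'}, forall x, i' (u x) = a (i x).
  apply: (factor_inj (h := lcomp a i) i'I) => x; apply/ex'.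
  by rewrite /= aP /= (_ : q (i x) = 0) ?linear0 //; apply/ex; exists x.
have [v vP] : exists v : {linear (K' * P)%type -> K},
    forall z, i (v z) = b (i' z.1) + (z.2 - b (a z.2)).
  apply: (factor_inj (h := ladd (lcomp b (lcomp i' (lfst K' P)))
    (lcomp (ladd (lid P) (lopp (lcomp b a))) (lsnd K' P))) iI) => -[x y].
  apply/ex; rewrite /= linearD linearB !bP /= aP /= rs subrr addr0.
  by rewrite (_ : g (i' x) = 0) ?linear0 //; apply/ex'; exists x.
exists (lpair u i), v => x; apply: iI.
by rewrite vP /= uP addrCA subrr addr0.
Qed.

Lemma retract_pdle n X Y : retract X Y -> pdle n Y -> pdle n X.
Proof.
elim: n X Y => [|n IH] X Y /=; first exact: retract_projective.
move=> XY [K [P [i [g [PP ig Kn]]]]].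
have [s [r rs]] := XY.
have gS : surjective_map (lcomp r g).
  by move=> x; have [iI gS ex] := ig; have [p pP] := gS (s x); exists p; rewrite /= pP.
exists (smod (kersub (lcomp r g))), P, (incl _), (lcomp r g); split => //.
  exact: ses_ker.
apply: IH (pdle_stab Kn PP).
exact: (kernel_retract (ses_ker gS) ig PP PP XY).
Qed.

Lemma iso_pdle n X Y : iso X Y -> pdle n X -> pdle n Y.
Proof. by move/iso_sym/iso_retract; apply: retract_pdle. Qed.

Lemma retract_refl X : retract X X. Proof. by exists (lid X), (lid X). Qed.

Lemma pdle_syzygy n K P M (i : {linear K -> P}) (g : {linear P -> M}) :
  ses i g -> projective P -> pdle n.+1 M -> pdle n K.
Proof.
move=> ig PP [K' [P' [i' [g' [P'P ig' K'n]]]]].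
apply: retract_pdle (pdle_stab K'n PP).
exact: (kernel_retract ig ig' PP P'P (retract_refl M)).
Qed.

Lemma pdle_ses n K P M (i : {linear K -> P}) (g : {linear P -> M}) :
  ses i g -> projective P -> pdle n K -> pdle n.+1 M.
Proof. by move=> ig PP Kn; exists K, P, i, g. Qed.

(** Pulling [X -> Y -> Z] back along a cover [p : P -> Y] gives the exact
    sequence of the syzygy of [Y], the syzygy of [Z] and [X]. *)
Lemma ses_rotate X Y Z P (f : {linear X -> Y}) (g : {linear Y -> Z})
    (p : {linear P -> Y}) :
  ses f g -> surjective_map p ->
  exists (u : {linear smod (kersub p) -> smod (kersub (lcomp g p))})
         (v : {linear smod (kersub (lcomp g p)) -> X}), ses u v.
Proof.
move=> [fI gS ex] pS.
have [u uP] : exists u : {linear smod (kersub p) -> smod (kersub (lcomp g p))},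
    forall x, incl _ (u x) = incl _ x.
  apply: (factor_inj (h := incl (kersub p))); first exact: smod_ext.
  move=> x; have px : mval x \in smem (kersub (lcomp g p)).
    by apply/mem_kersub; rewrite /= ((mem_kersub p _).1 (mvalP x)) linear0.
  by exists (Smod px).
have [v vP] : exists v : {linear smod (kersub (lcomp g p)) -> X},
    forall x, f (v x) = p (mval x).
  apply: (factor_inj (h := lcomp p (incl (kersub (lcomp g p)))) fI) => x.
  by apply/ex; have /mem_kersub := mvalP x.
exists u, v; split.
- by move=> x y xy; apply: smod_ext; rewrite -[mval x]uP -[mval y]uP xy.
- move=> x; have [y yP] := pS (f x).
  have yk : y \in smem (kersub (lcomp g p)).
    by apply/mem_kersub; rewrite /= yP; apply/ex; exists x.
  by exists (Smod yk); apply: fI; rewrite vP.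
move=> y; split => [vy|[x <-]].
  have yk : mval y \in smem (kersub p) by apply/mem_kersub; rewrite -vP vy linear0.
  by exists (Smod yk); apply: smod_ext; rewrite [mval _]uP.
apply: fI; rewrite vP linear0 [mval _]uP.
exact/mem_kersub/mvalP.
Qed.

(** The three bounds on the dimensions in an exact sequence [X -> Y -> Z] are
    proved together: rotating the sequence replaces the claim on one term by
    the claim on another: mid at [n] gives right at [n], which gives left at
    [n.+1]; and left at [n] gives mid at [n.+1]. *)
Let mid_at n := forall X Y Z (f : {linear X -> Y}) (g : {linear Y -> Z}),
  ses f g -> pdle n X -> pdle n Z -> pdle n Y.
Let left_at n := forall X Y Z (f : {linear X -> Y}) (g : {linear Y -> Z}),
  ses f g -> pdle n Y -> pdle n.+1 Z -> pdle n X.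
Let right_at n := forall X Y Z (f : {linear X -> Y}) (g : {linear Y -> Z}),
  ses f g -> pdle n X -> pdle n.+1 Y -> pdle n.+1 Z.

Lemma comp_surj X Y Z (f : {linear X -> Y}) (g : {linear Y -> Z}) :
  surjective_map f -> surjective_map g -> surjective_map (lcomp g f).
Proof. by move=> fS gS z; have [y <-] := gS z; have [x <-] := fS y; exists x. Qed.

Lemma right_of_mid n : mid_at n -> right_at n.
Proof.
move=> mid X Y Z f g fg Xn [K [P [i [p [PP ip Kn]]]]].
have pS : surjective_map p by case: ip.
have gS : surjective_map g by case: fg.
have [u [v uv]] := ses_rotate fg pS.
apply: (pdle_ses (ses_ker (comp_surj pS gS)) PP).
apply: mid uv _ Xn; apply: (pdle_syzygy (ses_ker pS) PP).
exact: pdle_ses ip PP Kn.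
Qed.

Lemma mid_of_left n : left_at n -> mid_at n.+1.
Proof.
move=> left X Y Z f g [fI gS ex] Xn Zn.
have [KX [PX [iX [pX [PXP [iXI pXS exX] KXn]]]]] := Xn.
have [KZ [PZ [iZ [pZ [PZP [iZI pZS exZ] KZn]]]]] := Zn.
have [t tP] := PZP _ _ g pZ gS.
pose p := ladd (lcomp f (lcomp pX (lfst PX PZ))) (lcomp t (lsnd PX PZ)).
have pS : surjective_map p.
  move=> y; have [z zP] := pZS (g y).
  have /ex[x xP] : g (y - t z) = 0 by rewrite linearB tP zP subrr.
  by have [w wP] := pXS x; exists (w, z); rewrite /= wP xP subrK.
have [u [v uv]] := ses_rotate (And3 fI gS ex) pS.
have PP := prod_projective PXP PZP.
apply: (pdle_ses (ses_ker pS) PP); apply: left uv _ Xn.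
exact: (pdle_syzygy (ses_ker (comp_surj pS gS)) PP).
Qed.

Lemma left_of_right n : right_at n -> left_at n.+1.
Proof.
move=> right X Y Z f g fg Yn Zn.
have [K [P [i [p [PP ip Kn]]]]] := Yn.
have pS : surjective_map p by case: ip.
have gS : surjective_map g by case: fg.
have [u [v uv]] := ses_rotate fg pS.
apply: right uv _ _; first exact: (pdle_syzygy (ses_ker pS) PP).
exact: (pdle_syzygy (ses_ker (comp_surj pS gS)) PP).
Qed.

Lemma pdle_mid_left n : mid_at n /\ left_at n.
Proof.
elim: n => [|n [mid left]].
  split; first by move=> X Y Z f g; apply: ses_projective.
  by move=> X Y Z f g fg YP; apply: pdle_syzygy fg YP.
by split; [apply: mid_of_left|apply/left_of_right/right_of_mid].
Qed.

Lemma pdle_mid n X Y Z (f : {linear X -> Y}) (g : {linear Y -> Z}) :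
  ses f g -> pdle n X -> pdle n Z -> pdle n Y.
Proof. exact: (pdle_mid_left n).1. Qed.
Lemma pdle_left n X Y Z (f : {linear X -> Y}) (g : {linear Y -> Z}) :
  ses f g -> pdle n Y -> pdle n.+1 Z -> pdle n X.
Proof. exact: (pdle_mid_left n).2. Qed.
Lemma pdle_right n X Y Z (f : {linear X -> Y}) (g : {linear Y -> Z}) :
  ses f g -> pdle n X -> pdle n.+1 Y -> pdle n.+1 Z.
Proof. exact: (right_of_mid (pdle_mid_left n).1). Qed.

Definition mod0 : lmodType R := 'rV[R]_0.
Lemma mod0P : zero_module mod0.
Proof. by move=> x; apply/rowP => -[]. Qed.

Lemma projective0 M : zero_module M -> projective M.
Proof.
move=> M0 X Y g f gS; exists (lzero M X) => x.
by rewrite (M0 x) !linear0.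
Qed.

Lemma ses_id M : ses (lzero mod0 M) (lid M).
Proof.
split; first by move=> x y _; rewrite (mod0P x) (mod0P y).
  by move=> x; exists x.
by move=> x; split => [/= ->|[? <-]] //; exists 0.
Qed.

Lemma pdle_S n M : pdle n M -> pdle n.+1 M.
Proof.
elim: n M => [|n IH] M.
  move=> MP; apply: (pdle_ses (ses_id M) MP); exact: projective0 mod0P.
by move=> [K [P [i [g [PP ig Kn]]]]]; apply: (pdle_ses ig PP); apply: IH.
Qed.

Lemma pdle_leq m n M : (m <= n)%N -> pdle m M -> pdle n M.
Proof. by move=> /subnK <- h; elim: (n - m)%N => // k; apply: pdle_S. Qed.

Lemma projective_pdle n M : projective M -> pdle n M.
Proof. exact: (@pdle_leq 0). Qed.

Definition fpd M := exists n, pdle n M.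

Lemma fpd_mid X Y Z (f : {linear X -> Y}) (g : {linear Y -> Z}) :
  ses f g -> fpd X -> fpd Z -> fpd Y.
Proof.
move=> fg [m Xm] [n Zn]; exists (maxn m n).
by apply: pdle_mid fg (pdle_leq _ Xm) (pdle_leq _ Zn); rewrite ?leq_maxl ?leq_maxr.
Qed.
Lemma fpd_right X Y Z (f : {linear X -> Y}) (g : {linear Y -> Z}) :
  ses f g -> fpd X -> fpd Y -> fpd Z.
Proof.
move=> fg [m Xm] [n Yn]; exists (maxn m n).+1.
by apply: pdle_right fg (pdle_leq _ Xm) (pdle_leq _ Yn); rewrite ?leq_maxl // leqW ?leq_maxr.
Qed.

(** Drop the first term of the resolution; what is left resolves the kernel of
    the augmentation. *)
Lemma resolution_pdle n M :
  (exists F d eps, @projective_resolution R M n F d eps) -> pdle n M.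
Proof.
elim: n M => [|n IH] M [P [d [eps [PP P0 epsS ex0 ex]]]].
  apply: (retract_projective _ (PP 0%N)); apply/iso_retract/iso_sym/(bij_iso (f := eps)) => //.
  by apply/lin_inj => x /ex0 [y <-]; rewrite (P0 1%N _ y) // linear0.
have [e eP] : exists e : {linear P 1%N -> smod (kersub eps)}, forall x, incl _ (e x) = d 0%N x.
  apply: (factor_inj (h := d 0%N)); first exact: smod_ext.
  move=> x; have h : d 0%N x \in smem (kersub eps) by apply/mem_kersub/ex0; exists x.
  by exists (Smod h).
apply: (pdle_ses (ses_ker epsS) (PP 0%N)); apply: IH.
exists (fun i => P i.+1), (fun i => d i.+1), e; split.
- by move=> i; apply: PP.
- by move=> i; rewrite -ltnS; apply: P0.
- move=> x; have /ex0[y yP] : eps (mval x) = 0 by apply/mem_kersub/mvalP.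
  by exists y; apply: smod_ext; rewrite -[LHS]/(incl _ _) eP.
- move=> y; split => [ey|/(ex 0%N) dy].
    by apply/(ex 0%N); rewrite -eP ey.
  by apply: smod_ext; rewrite -[LHS]/(incl _ _) eP dy.
by move=> i; apply: ex.
Qed.

Definition cons_mod P (F : nat -> lmodType R) (j : nat) : lmodType R :=
  if j is j'.+1 then F j' else P.

Definition cons_diff P (F : nat -> lmodType R)
    (d : forall j, {linear F j.+1 -> F j}) (e : {linear F 0%N -> P}) (j : nat) :
    {linear cons_mod P F j.+1 -> cons_mod P F j} :=
  match j return {linear cons_mod P F j.+1 -> cons_mod P F j} with
  | 0%N => e
  | j'.+1 => d j'
  end.

Lemma pdle_resolution n M :
  pdle n M -> exists F d eps, @projective_resolution R M n F d eps.
Proof.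
elim: n M => [|n IH] M.
  move=> MP.
  exists (fun i => if i is _.+1 then mod0 else M), (fun i => lzero mod0 _), (lid M).
  split.
  - by case=> [|i] //; exact: projective0 mod0P.
  - by case=> [|i] // _; exact: mod0P.
  - by move=> x; exists x.
  - by move=> y; split => [/= ->|[x <-]] //; exists 0.
  by move=> i y; split => // _; exists 0; rewrite (mod0P y).
move=> [K [P [i [g [PP [iI gS ex] /IH[P' [d' [e [PP' P0' eS ex0' ex']]]]]]]]].
exists (cons_mod P P'), (cons_diff d' (lcomp i e)), g.
split.
- by case.
- by case=> // j; rewrite ltnS; apply: P0'.
- by [].
- move=> y; split => [/ex[k <-]|[x <-]]; last by apply/ex; exists (e x).
  by have [x <-] := eS k; exists x.
case=> [|j]; last exact: ex'.
move=> y; split => [iey|/ex0' ey]; last by rewrite /= ey linear0.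
by apply/ex0'/iI; rewrite linear0.
Qed.

Lemma pd_leP n M : enat_le (pd M) (Some n) <-> pdle n M.
Proof.
rewrite /pd /enat_least; case: pselect => [exP|nex] /=.
  case: ex_minnP => m /asboolP/resolution_pdle mM min.
  split => [le_mn|nM]; first exact: pdle_leq le_mn mM.
  by apply: min; apply/asboolP/pdle_resolution.
split=> // nM; case: nex; exists n; exact/asboolP/pdle_resolution.
Qed.

Lemma pd_fin M : pd M <> None <-> fpd M.
Proof.
split => [|[n /pd_leP]]; last by case: (pd M).
by case e : (pd M) => [m|] // _; exists m; apply/pd_leP; rewrite e /= leqnn.
Qed.

End Homological.

(** * Uniserial modules *)
Section Uniserial.
Variable R : pzRingType.
Implicit Types M N P X Y K L Q S T : lmodType R.

#[local] Hint Resolve sle_refl : core.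

(** The submodules of [M] are exactly the terms of a strict chain of length
    [n].  In contrast with [serial], this passes at once to submodules and
    quotients and gives the comparability of submodules directly. *)
Definition uniserial M (n : nat) := exists U : nat -> submod M,
  (forall V, exists2 i, (i <= n)%N & V = U i) /\
  (forall i j, (i <= n)%N -> (j <= n)%N -> sle (U i) (U j) <-> (i <= j)%N).

Lemma uniserial_total M n : uniserial M n ->
  forall V W : submod M, sle V W \/ sle W V.
Proof.
move=> [U [Uall Ule]] V W; have [i ilt ->] := Uall V; have [j jlt ->] := Uall W.
by case/orP: (leq_total i j) => h; [left|right]; apply/Ule.
Qed.

Lemma not_sle M (U V : submod M) : ~ sle U V ->
  exists2 x, x \in smem U & x \notin smem V.
Proof.
move=> nUV; apply: contrapT => nex; apply: nUV => x xU.
by apply: contrapT => /negP xV; apply: nex; exists x.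
Qed.

Lemma subzero_nle M (U : submod M) : U <> subzero M ->
  exists2 x, x \in smem U & x <> 0.
Proof.
move=> U0; have [x xU x0] : exists2 x, x \in smem U & x \notin smem (subzero M).
  by apply: not_sle => h; apply/U0/sle_anti => //; apply: sub0le.
by exists x => // e; move/negP: x0; apply; apply/psubP.
Qed.

Lemma uniserial_uniq M m n : uniserial M m -> uniserial M n -> m = n.
Proof.
have le m' n' : uniserial M m' -> uniserial M n' -> (m' <= n')%N.
  move=> [U [Uall Ule]] [V [Vall Vle]].
  have [|f fP] := @choice nat nat (fun i j => (j <= n')%N /\ U i = V j).
    by move=> i; have [j jn ej] := Vall (U i); exists j.
  have fn i : (f i < n'.+1)%N by have [] := fP i.
  have fI : injective (fun i : 'I_m'.+1 => Ordinal (fn i)).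
    move=> i j /(congr1 val) /= fij; apply: val_inj => /=.
    have [_ ei] := fP i; have [_ ej] := fP j.
    have eU : U i = U j by rewrite ei ej fij.
    have im : (i <= m')%N by rewrite -ltnS.
    have jm : (j <= m')%N by rewrite -ltnS.
    by apply/eqP; rewrite eqn_leq; apply/andP; split; apply/Ule => //; rewrite eU.
  by have := leq_card _ fI; rewrite !card_ord.
by move=> h k; apply/eqP; rewrite eqn_leq !le.
Qed.

(** The submodules of [X] correspond to the submodules of [M] below the image
    of [f], an initial segment of the chain. *)
Lemma uniserial_inj X M (f : {linear X -> M}) n : injective f -> uniserial M n ->
  exists m, [/\ (m <= n)%N, uniserial X m & m = n -> surjective_map f].
Proof.
move=> fI [U [Uall Ule]].
have [m mn im] := Uall (imsub f (subfull X)); exists m; split=> //.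
  exists (fun i => presub f (U i)); split.
    move=> V; have [i ilt Vi] := Uall (imsub f V).
    have im' : (i <= m)%N.
      apply/Ule => //; rewrite -Vi -im => y /psubP [x xV <-].
      exact/mem_im/subfullP.
    exists i => //; apply: sle_anti => x.
      by move=> xV; apply/psubP; rewrite -Vi; apply: mem_im.
    by move/psubP; rewrite -Vi => /psubP[z zV /fI <-].
  move=> i j ilt jlt; split => [h|ij].
    apply/Ule; rewrite ?(leq_trans _ mn) // => y yi.
    have : y \in smem (U m) by move: y yi; apply/Ule; rewrite ?(leq_trans _ mn).
    rewrite -im => /psubP[x _ fx]; rewrite -fx.
    have /psubP // : x \in smem (presub f (U j)) by apply: h; apply/psubP; rewrite fx.
  move=> x /psubP fx; apply/psubP; move: (f x) fx.
  by apply/Ule; rewrite ?(leq_trans _ mn).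
move=> emn y; have [k kn ek] := Uall (subfull M).
have : y \in smem (U m).
  have : y \in smem (subfull M) by apply: subfullP.
  by rewrite ek; move: (y); apply/Ule; rewrite ?emn.
by rewrite -im => /psubP[x _ <-]; exists x.
Qed.

(** The submodules of [X] correspond to the submodules of [M] above the kernel
    of [f], a final segment of the chain. *)
Lemma uniserial_surj M X (f : {linear M -> X}) n : surjective_map f -> uniserial M n ->
  exists m, [/\ (m <= n)%N, uniserial X m & m = n -> injective f].
Proof.
move=> fS [U [Uall Ule]].
have [k kn kr] := Uall (kersub f).
have imK V : presub f (imsub f V) = subsum V (U k).
  apply: sle_anti => x; rewrite -kr.
    move/psubP/psubP => [y yV fyx]; apply/psubP; exists y, (x - y).
    split=> //; last by rewrite addrC subrK.
    by apply/mem_kersub; rewrite linearB fyx subrr.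
  move/psubP => [u [v [uV /mem_kersub fv ->]]]; apply/psubP.
  by rewrite linearD fv addr0; apply: mem_im.
have preK (V : submod X) : imsub f (presub f V) = V.
  apply: sle_anti => y; first by move/psubP => [x /psubP xV <-].
  by have [x <-] := fS y => fx; apply: mem_im; apply/psubP.
have sumK i : (k <= i)%N -> (i <= n)%N -> presub f (imsub f (U i)) = U i.
  move=> ki ilt; rewrite imK; apply: sle_anti => x.
    move/psubP => [u [v [uU vU ->]]]; rewrite rpredD //.
    by move: v vU; apply/Ule.
  by move=> xU; apply/psubP; exists x, 0; rewrite addr0 rpred0.
exists (n - k)%N; rewrite leq_subr; split=> //.
  exists (fun i => imsub f (U (i + k)%N)); split.
    move=> V; have [i ilt Vi] := Uall (presub f V).
    have ki : (k <= i)%N.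
      apply/Ule => //; rewrite -Vi -kr => x /mem_kersub fx.
      by apply/psubP; rewrite fx rpred0.
    by exists (i - k)%N; [exact: leq_sub2r|rewrite subnK // -Vi preK].
  move=> i j; rewrite !leq_subRL // ![(k + _)%N]addnC => ilt jlt.
  split => [h|h].
    rewrite -(leq_add2r k); apply/Ule => //.
    rewrite -(sumK (i + k)%N) ?leq_addl // -(sumK (j + k)%N) ?leq_addl //.
    by move=> x /psubP xi; apply/psubP/h.
  move=> y /psubP[x xi <-]; apply: mem_im; move: x xi.
  by apply/Ule => //; rewrite leq_add2r.
move=> e; have k0 : k = 0%N.
  by have := subnK kn; rewrite e => /eqP; rewrite -[X in _ == X]addn0 eqn_add2l => /eqP.
apply/lin_inj => x /mem_kersub; rewrite kr k0.
have [i ilt ei] := Uall (subzero M).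
have : sle (U 0%N) (U i) by apply/Ule.
by rewrite -ei => h /h /psubP.
Qed.

Lemma uniserial_iso X M n : iso X M -> uniserial M n -> uniserial X n.
Proof.
move=> [f [g [fg gf]]] h.
have [m [mn Xm]] := uniserial_inj (f := f) (can_inj fg) h.
have [m' [mm' Mm']] := uniserial_inj (f := g) (can_inj gf) Xm.
have e := uniserial_uniq h Mm'.
by rewrite -(_ : m = n) //; apply/eqP; rewrite eqn_leq mn /= e.
Qed.

Lemma pred_sub M n (W : submod M) : uniserial M n -> W <> subzero M ->
  exists V, [/\ sle V W, V <> W & forall V', sle V' W -> V' <> W -> sle V' V].
Proof.
move=> [U [Uall Ule]] W0; have [i ilt ei] := Uall W.
have i0 : (0 < i)%N.
  rewrite lt0n; apply/negP => /eqP i0; apply: W0; apply: sle_anti; last exact: sub0le.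
  by have [j jlt ->] := Uall (subzero M); rewrite ei i0; apply/Ule.
exists (U i.-1); have i1 : (i.-1 <= n)%N by rewrite (leq_trans (leq_pred _)).
rewrite ei; split.
- by apply/Ule => //; exact: leq_pred.
- move=> e; have : (i <= i.-1)%N by apply/Ule => //; rewrite e.
  by rewrite leqNgt ltn_predL i0.
move=> V' V'i V'n; have [j jlt ej] := Uall V'.
rewrite ej; apply/Ule => //; rewrite -ltnS prednK // ltn_neqAle.
apply/andP; split; last by apply/Ule; rewrite -?ej.
by apply/negP => /eqP e; apply: V'n; rewrite ej e.
Qed.

Lemma max_sub M n : uniserial M n -> ~ zero_module M ->
  exists V, V <> subfull M /\ forall V', V' <> subfull M -> sle V' V.
Proof.
move=> h M0; have [|V [VW VnW Vm]] := pred_sub (W := subfull M) h.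
  move=> e; apply: M0 => x; have : x \in smem (subfull M) by apply: subfullP.
  by rewrite e => /psubP.
by exists V; split => // V' V'n; apply: Vm => //; apply: lefull.
Qed.

Lemma socle M n : uniserial M n -> ~ zero_module M ->
  exists W, W <> subzero M /\ forall V, V <> subzero M -> sle W V.
Proof.
move=> [U [Uall Ule]] M0.
have [z zn ez] := Uall (subzero M).
have z0 : z = 0%N.
  by apply/eqP; rewrite -leqn0; apply/Ule => //; rewrite -ez; apply: sub0le.
have n0 : (0 < n)%N.
  rewrite lt0n; apply/negP => /eqP n0; apply: M0 => x.
  have : x \in smem (subfull M) by apply: subfullP.
  have [i ilt ->] := Uall (subfull M).
  have -> : i = 0%N by apply/eqP; rewrite -leqn0 -n0.
  by rewrite -z0 -ez => /psubP.
exists (U 1%N); split.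
  rewrite ez z0 => e; have : (1 <= 0)%N by apply/Ule => //; rewrite e.
  by [].
move=> V V0; have [i ilt ei] := Uall V; rewrite ei; apply/Ule => //.
by rewrite lt0n; apply/negP => /eqP i0; apply: V0; rewrite ei i0 ez z0.
Qed.

Lemma simpleP S : simple_module S <->
  ~ zero_module S /\ forall U : submod S, U = subzero S \/ U = subfull S.
Proof.
split=> [[S0 h]|[S0 h]]; split=> // U.
  case: (h _ (submodP U)) => e; [left|right]; apply: submod_ext => x; rewrite e.
    by apply/idP/psubP => [/eqP|->] //; rewrite inE.
  by rewrite subfullP.
move=> Uc; case: (h (Submod Uc)) => e; [left|right] => x.
  by rewrite -[x \in U]/(x \in smem (Submod Uc)) e; apply/psubP/idP => [->|/eqP] //; rewrite inE.
by rewrite -[x \in U]/(x \in smem (Submod Uc)) e subfullP.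
Qed.

Lemma nonzero_ex M : ~ zero_module M -> exists x : M, x <> 0.
Proof.
by move=> h; apply: contrapT => nex; apply: h => x; apply: contrapT => x0; apply: nex; exists x.
Qed.

Lemma ker_trivial_inj X Y (f : {linear X -> Y}) :
  kersub f = subzero X -> injective f.
Proof.
by move=> e; apply/lin_inj => x /mem_kersub; rewrite e => /psubP.
Qed.

Lemma im_full_surj X Y (f : {linear X -> Y}) :
  imsub f (subfull X) = subfull Y -> surjective_map f.
Proof.
move=> e y; have : y \in smem (subfull Y) by apply: subfullP.
by rewrite -e => /psubP[x _ <-]; exists x.
Qed.

Lemma simple_iso S T (f : {linear S -> T}) x :
  simple_module S -> simple_module T -> f x <> 0 -> iso S T.
Proof.
move=> /simpleP[S0 hS] /simpleP[T0 hT] fx; apply: (@bij_iso _ _ _ f).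
  apply: ker_trivial_inj; case: (hS (kersub f)) => // e; case: fx.
  by apply/mem_kersub; rewrite e subfullP.
apply: im_full_surj; case: (hT (imsub f (subfull S))) => // e; case: fx.
have : f x \in smem (imsub f (subfull S)) by apply/mem_im/subfullP.
by rewrite e => /psubP.
Qed.

(** The quotient by a maximal submodule is simple; [simple_ker] is the
    converse. *)
Lemma simple_surj X T (f : {linear X -> T}) : surjective_map f ->
  kersub f <> subfull X ->
  (forall V, sle (kersub f) V -> V <> subfull X -> sle V (kersub f)) ->
  simple_module T.
Proof.
move=> fS kf km; apply/simpleP; split.
  by move=> T0; apply: kf; apply: submod_ext => x; rewrite subfullP; apply/mem_kersub.
move=> U; case: (pselect (presub f U = subfull X)) => e.
  right; apply: sle_anti; first exact: lefull.
  move=> y _; have [x <-] := fS y.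
  have : x \in smem (presub f U) by rewrite e subfullP.
  by move/psubP.
left; apply: sle_anti; last exact: sub0le.
move=> y; have [x <-] := fS y => fx; apply/psubP/mem_kersub.
apply: (km (presub f U)) => //; last exact/psubP.
by move=> z /mem_kersub fz; apply/psubP; rewrite fz rpred0.
Qed.

Lemma simple_ker X T (f : {linear X -> T}) : simple_module T -> surjective_map f ->
  kersub f <> subfull X /\ (forall V, sle (kersub f) V -> V <> kersub f -> V = subfull X).
Proof.
move=> /simpleP[T0 hT] fS; split.
  move=> e; apply: T0 => y; have [x <-] := fS y.
  by apply/mem_kersub; rewrite e subfullP.
move=> V kV nV; apply: sle_anti; first exact: lefull.
case: (hT (imsub f V)) => e.
  case: nV; apply: sle_anti => // x xV; apply/mem_kersub.
  by have := mem_im f xV; rewrite e => /psubP.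
move=> x _; have : f x \in smem (imsub f V) by rewrite e subfullP.
move/psubP => [v vV fvx]; rewrite -(subrK v x) rpredD //.
by apply: kV; apply/mem_kersub; rewrite linearB fvx subrr.
Qed.

Lemma simple_uniserial S : simple_module S -> uniserial S 1.
Proof.
move=> /simpleP[S0 hS].
exists (fun i => if i is 0%N then subzero S else subfull S); split.
  by move=> U; case: (hS U) => ->; [exists 0%N|exists 1%N].
move=> [|i] [|j] /= ilt jlt.
- by split=> // _; apply: sle_refl.
- by split=> // _; apply: sub0le.
- by split=> // h; case: S0 => x; have /h/psubP : x \in smem (subfull S) by apply: subfullP.
by move: ilt jlt; rewrite !ltnS !leqn0 => /eqP-> /eqP->; split=> // _; apply: sle_refl.
Qed.

(** The two submodules are comparable, so the smaller one is their intersection;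
    likewise the larger one is their sum in [uniserial_sum]. *)
Lemma uniserial_cap M n (V W : submod M) : uniserial M n ->
  (forall x, x \in smem V -> x \in smem W -> x = 0) -> V <> subzero M -> W = subzero M.
Proof.
move=> h VW V0; case: (uniserial_total h V W) => le.
  by case: (subzero_nle V0) => x xV; case; apply: VW => //; apply: le.
apply: sle_anti; last exact: sub0le.
by move=> x xW; apply/psubP/VW => //; apply: le.
Qed.

Lemma uniserial_sum M n (V W : submod M) : uniserial M n ->
  (forall x, exists u v, [/\ u \in smem V, v \in smem W & x = u + v]) ->
  V <> subfull M -> W = subfull M.
Proof.
move=> h VW V0; case: (uniserial_total h V W) => le; apply: sle_anti => //; try exact: lefull.
  move=> x _; have [u [v [uV vW ->]]] := VW x; rewrite rpredD //; exact: le.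
case: V0; apply: sle_anti; first exact: lefull.
move=> x _; have [u [v [uV vW ->]]] := VW x; rewrite rpredD //; exact: le.
Qed.

Definition covers M (V W : submod M) :=
  [/\ sle V W, V <> W & forall Z, sle V Z -> sle Z W -> Z = V \/ Z = W].

(** If no term of a maximal chain can be replaced by another submodule, then
    the chain contains every submodule.  Induction on the least term [U k.+1]
    containing [V].  Put [V :&: U k = U i].  If [i = k], then [V] lies between
    [U k] and [U k.+1].  Otherwise [V + U k.-1] meets [U k] in [U k.-1] by the
    modular law, so it could replace [U k] in the chain, although it is not
    contained in [U k]. *)
Lemma rigid_chain_all M n (U : nat -> submod M) :
  U 0%N = subzero M -> (forall i, (i < n)%N -> covers (U i) (U i.+1)) ->
  (forall i V, (i.+1 < n)%N -> covers (U i) V -> covers V (U i.+2) -> V = U i.+1) ->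
  forall k, (k <= n)%N -> forall V, sle V (U k) -> exists2 i, (i <= k)%N & V = U i.
Proof.
move=> U0 Uc Uu; elim=> [|k IH] kn V Vk.
  by exists 0%N => //; apply: sle_anti; rewrite // U0; apply: sub0le.
have kn' : (k <= n)%N by apply: ltnW.
have [kle kne kc] := Uc k kn.
have [i ik ei] : exists2 i, (i <= k)%N & subcap V (U k) = U i.
  by apply: IH => // x /psubP[].
case: (pselect (sle V (U k))) => [Vle|nVle].
  have [j jk ej] := IH kn' V Vle.
  by exists j => //; apply: leqW.
have [ekI|ltik] := eqVneq i k.
  have : sle (U k) V by rewrite -[in X in sle X]ekI -ei => x /psubP[].
  by move=> kV; case: (kc V kV Vk) => ->; [exists k; rewrite ?leqnSn|exists k.+1].
have {ltik ik} : (i < k)%N by rewrite ltn_neqAle ltik.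
(* From here on the top term is [U k.+2], and [V :&: U k.+1 = U i] with
   [i <= k]. *)
case: k => // k in kn kn' IH kle kne kc Vk ei nVle *.
rewrite ltnS => ik.
have [kle1 kne1 kc1] := Uc k (ltnW kn).
have mono : forall a b, (a <= b)%N -> (b <= n)%N -> sle (U a) (U b).
  move=> a; elim=> [|b IHb]; first by rewrite leqn0 => /eqP ->.
  rewrite leq_eqVlt => /orP[/eqP -> //|ab] bn.
  by have [h _ _] := Uc b bn; apply: sle_trans h; apply: IHb => //; apply: ltnW.
pose W := subsum V (U k).
have WU : forall x, x \in smem W -> x \in smem (U k.+1) -> x \in smem (U k).
  move=> x /psubP[u [v [uV vU ->]]] uvU.
  have uU : u \in smem (U k.+1) by rewrite -(addrK v u) rpredB //; apply: kle1.
  rewrite rpredD //; apply: (mono i k ik (ltnW (ltnW kn))).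
  by rewrite -ei; apply/psubP.
have kW : sle (U k) W.
  by move=> x xU; apply/psubP; exists 0, x; rewrite add0r rpred0.
have Wk2 : sle W (U k.+2).
  move=> x /psubP[u [v [uV vU ->]]]; rewrite rpredD //; first exact: Vk.
  by apply/kle/kle1.
have [y yV yU] := not_sle nVle.
have yW : y \in smem W by apply/psubP; exists y, 0; rewrite addr0 rpred0.
have big (Z : submod M) : sle Z (U k.+2) -> ~ sle Z (U k.+1) ->
    forall x, x \in smem (U k.+2) -> exists u v,
    [/\ u \in smem Z, v \in smem (U k.+1) & x = u + v].
  move=> Zle Zn x xU; have [|z|e|e] := kc (subsum Z (U k.+1)).
  - by move=> z zU; apply/psubP; exists 0, z; rewrite add0r rpred0.
  - by move/psubP => [u [v [uZ vU ->]]]; rewrite rpredD //; [apply: Zle|apply: kle].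
  - case: Zn => z zZ; rewrite -e; apply/psubP.
    by exists z, 0; rewrite addr0 rpred0.
  by move: xU; rewrite -e => /psubP.
suff e : W = U k.+1 by move/negP: yU; rewrite -e.
apply: Uu => //.
  split=> //; first by move=> e; move/negP: yU; apply; apply: kle1; rewrite e.
  move=> Z kZ ZW; case: (pselect (sle Z (U k.+1))) => ZU.
    by left; apply: sle_anti => // x xZ; apply: WU; [apply: ZW|apply: ZU].
  right; apply: sle_anti => // x xW.
  have [u [v [uZ vU e]]] := big Z (sle_trans ZW Wk2) ZU x (Wk2 x xW).
  rewrite e rpredD //; apply: kZ; apply: WU => //.
  have -> : v = x - u by rewrite e addrAC subrr add0r.
  by rewrite rpredB //; apply: ZW.
split=> //.
  move=> e; apply: kne1; apply: sle_anti => // x xU.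
  by apply: WU => //; rewrite e; apply: kle.
move=> Z WZ Zle.
case: (kc1 (subcap Z (U k.+1))).
- by move=> x xU; apply/psubP; split; [apply/WZ/kW|apply: kle1].
- by move=> x /psubP[].
- move=> e; left; apply: sle_anti => // x xZ.
  have nW : ~ sle W (U k.+1) by move=> h; move/negP: yU; apply; apply: h.
  have [u [v [uW vU ex]]] := big W Wk2 nW x (Zle x xZ).
  rewrite ex rpredD //; apply: kW; rewrite -e; apply/psubP; split=> //.
  have -> : v = x - u by rewrite ex addrAC subrr add0r.
  by rewrite rpredB //; apply: WZ.
- move=> e; right; case: (kc Z) => //.
    by rewrite -e => x /psubP[].
  by move=> eZ; move/negP: yU; case; rewrite -eZ; apply: WZ.
Qed.

(** Replacing one term of the composition series gives another composition
    series, so uniqueness makes the chain rigid. *)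
Lemma serial_uniserial M : serial M -> exists n, uniserial M n.
Proof.
move=> [[n [U0 Us]] uniq].
have [Ua Ub Uc Ud] := Us.
have [U UP] : exists U : nat -> submod M, forall i, (i <= n)%N -> smem (U i) =i U0 i.
  have [|U UP] := @choice nat (submod M) (fun i W => (i <= n)%N -> smem W =i U0 i).
    move=> i; have [ilt|_] := leqP i n; last by exists (subzero M).
    by exists (Submod (Uc i ilt)).
  by exists U.
have cov i : (i < n)%N -> covers (U i) (U i.+1).
  move=> ilt; have [h1 h2 h3] := Ud i ilt.
  have ile := ltnW ilt; split.
  - by move=> x; rewrite !UP //; apply: h1.
  - by move=> e; apply: h2 => x; rewrite -!UP // e.
  move=> Z h4 h5; have [||e|e] := h3 _ (submodP Z).
  - by move=> x; rewrite -UP //; apply: h4.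
  - by move=> x /h5; rewrite UP.
  - by left; apply: submod_ext => x; rewrite e UP.
  - by right; apply: submod_ext => x; rewrite e UP.
have z0 : U 0%N = subzero M.
  by apply: submod_ext => x; rewrite UP // Ua inE; apply/eqP/psubP.
have nf : U n = subfull M.
  by apply: submod_ext => x; rewrite UP // Ub subfullP.
exists n, U; split.
  move=> V; apply: (rigid_chain_all z0 cov _ (leqnn n)) => //; last by rewrite nf; apply: lefull.
  move=> {}i {}V ilt c1 c2.
  pose V' j := if j == i.+1 then V else U j.
  have cs : composition_series n (fun j => smem (V' j)).
    have c j : (j < n)%N -> covers (V' j) (V' j.+1).
      rewrite /V' eqSS => jn; have [->|ji] := eqVneq j i.
        by rewrite (ltn_eqF (ltnSn i)).
      by case: eqP => [->|_] //; apply: cov.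
    split.
    - by move=> x; rewrite /V' /= z0; apply/psubP/idP => [->|/eqP] //; rewrite inE.
    - by rewrite /V' (gtn_eqF ilt) nf => x; rewrite subfullP.
    - by move=> j _; apply: submodP.
    move=> j jn; have [k1 k2 k3] := c j jn; split=> //.
      by move=> e; apply: k2; apply: submod_ext.
    move=> Z Zc h1 h2; have [||e|e] := k3 (Submod Zc) => //.
      by left=> x; rewrite -e.
    by right=> x; rewrite -e.
  have [_ e] := uniq _ _ _ _ cs Us.
  apply: submod_ext => x; have := e i.+1 (ltnW ilt) x.
  by rewrite /V' eqxx UP // ltnW.
have mono : forall a b, (a <= b)%N -> (b <= n)%N -> sle (U a) (U b).
  move=> a; elim=> [|b IHb]; first by rewrite leqn0 => /eqP ->.
  rewrite leq_eqVlt => /orP[/eqP -> //|ab] bn.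
  by have [h _ _] := cov b bn; apply: sle_trans h; apply: IHb => //; apply: ltnW.
move=> i j ilt jlt; split => [h|h]; last exact: mono.
rewrite leqNgt; apply/negP => ji.
have [k1 k2 _] := cov j (leq_trans ji ilt).
apply: k2; apply: sle_anti => //; apply: sle_trans h.
exact: mono.
Qed.

End Uniserial.

(** * Injectivity criteria *)
Section Baer.
Variable R : pzRingType.
Implicit Types M N Q : lmodType R.

(** Zorn's lemma applies to partial extensions of [f], represented by their
    graphs in [N * Q].  A maximal graph [H] is defined at each [n]: the [a] such
    that [H] is defined at [a *: n] form a left ideal [J], and the value [e] at [1]
    of an extension of the induced map [J -> Q] allows [(n, e)] to be added to
    [H]. *)
Lemma baer_criterion Q :
  (forall (J : submod (R^o : lmodType R)) (f : {linear smod J -> Q}),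
     exists e : Q, forall a : smod J, f a = (mval a : R) *: e) ->
  injective_module Q.
Proof.
move=> bQ M N g f gI.
pose base := imsub (lpair g f) (subfull M).
pose ok (G : submod (N * Q)%type) :=
  (forall q, (0, q) \in smem G -> q = 0) /\ sle base G.
have bok : ok base.
  split=> // q /psubP[x _ [gx <-]]; move: gx; rewrite -(linear0 g) => /gI ->.
  by rewrite linear0.
pose T := {G | ok G}.
pose le (G H : T) : bool := `[< sle (proj1_sig G) (proj1_sig H) >].
have text (G H : T) : proj1_sig G = proj1_sig H -> G = H.
  case: G H => [G HG] [H HH] /= e; move: HH; rewrite -e => HH.
  by rewrite (Prop_irrelevance HG HH).
have [||||G Gmax] := @classical_sets.Zorn T le.
- by move=> G; apply/asboolP.
- move=> G H K /asboolP h /asboolP k; apply/asboolP; exact: sle_trans k.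
- move=> G H /asboolP h /asboolP k; apply: text; exact: sle_anti.
- move=> A Atot.
  pose B (G : submod (N * Q)%type) := G = base \/ exists2 H : T, A H & G = proj1_sig H.
  have Bok G : B G -> ok G by case=> [->|[H _ ->]] //; apply: proj2_sig.
  have Btot G H : B G -> B H -> sle G H \/ sle H G.
    move=> [->|[G' AG ->]]; first by move=> /Bok[_ h]; left.
    move=> [->|[H' AH ->]]; first by right; have [_] := proj2_sig G'.
    by case: (Atot _ _ AG AH) => /asboolP h; [left|right].
  have U0 : exists2 G, B G & (0 : (N * Q)%type) \in smem G.
    by exists base; [exact: or_introl|rewrite rpred0].
  have UD a (x y : (N * Q)%type) : (exists2 G, B G & x \in smem G) ->
      (exists2 G, B G & y \in smem G) -> exists2 G, B G & a *: x + y \in smem G.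
    move=> [G BG xG] [H BH yH]; case: (Btot _ _ BG BH) => h.
      by exists H => //; rewrite rpredD ?rpredZ //; apply: h.
    by exists G => //; rewrite rpredD ?rpredZ //; apply: h.
  pose U := psub U0 UD.
  have Uok : ok U.
    split; first by move=> q /psubP[G /Bok[h _] /h].
    by move=> x xb; apply/psubP; exists base => //; apply: or_introl.
  exists (exist _ U Uok) => G AG; apply/asboolP => x xG /=; apply/(psubP U0 UD).
  by exists (proj1_sig G) => //; right; exists G.
have [G0 Gb] := proj2_sig G; set H := proj1_sig G in G0 Gb.
have Gfun n q q' : (n, q) \in smem H -> (n, q') \in smem H -> q = q'.
  move=> h k; apply/eqP; rewrite -subr_eq0; apply/eqP/G0.
  have -> : (0, q - q') = (n, q) - (n, q') :> (N * Q)%type by congr pair; rewrite subrr.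
  exact: rpredB.
have Gtot n : exists q, (n, q) \in smem H.
  have J0 : exists q, ((0 : R) *: n, q) \in smem H.
    by exists 0; rewrite scale0r; apply: rpred0.
  have JD (a x y : R) : (exists q, (x *: n, q) \in smem H) ->
      (exists q, (y *: n, q) \in smem H) -> exists q, ((a * x + y) *: n, q) \in smem H.
    move=> [q xq] [q' yq']; exists (a *: q + q').
    have -> : ((a * x + y) *: n, a *: q + q') = a *: (x *: n, q) + (y *: n, q').
      by congr pair; rewrite scalerDl -scalerA.
    by rewrite rpredD ?rpredZ.
  pose J := @psub R R^o (fun x : R => exists q, (x *: n, q) \in smem H) J0 JD.
  have [|||h hP] := @linear_of_relation R (smod J) Q (fun a q => ((mval a : R) *: n, q) \in smem H).
  - by move=> [a aJ]; apply/(@psubP _ R^o _ J0 JD).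
  - by move=> q; rewrite linear0 scale0r; apply: G0.
  - move=> a x x' y y' h h'.
    have -> : ((mval (a *: x + x') : R) *: n, a *: y + y') =
       a *: ((mval x : R) *: n, y) + ((mval x' : R) *: n, y') :> (N * Q)%type.
      by congr pair; rewrite linearP scalerDl -scalerA.
    by rewrite rpredD ?rpredZ.
  have [e eP] := bQ J h.
  have H0 : exists (z : (N * Q)%type) (a : R), z \in smem H /\ 0 = z + a *: (n, e).
    by exists 0, 0; rewrite rpred0 scale0r addr0.
  have HD (a : R) (x y : (N * Q)%type) :
     (exists (z : (N * Q)%type) (b : R), z \in smem H /\ x = z + b *: (n, e)) ->
     (exists (z : (N * Q)%type) (b : R), z \in smem H /\ y = z + b *: (n, e)) ->
     exists (z : (N * Q)%type) (b : R), z \in smem H /\ a *: x + y = z + b *: (n, e).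
    move=> [z [b [zH ->]]] [z' [b' [zH' ->]]]; exists (a *: z + z'), (a * b + b').
    split; first by rewrite rpredD ?rpredZ.
    by rewrite scalerDr scalerDl scalerA addrACA.
  pose H' := psub H0 HD.
  (* If [z + b *: (n, e)] has first component [0], then [- b] lies in [J], so the
     two contributions to the second component cancel. *)
  have H'ok : ok H'.
    split; last first.
      by move=> x xb; apply/(psubP H0 HD); exists x, 0; rewrite scale0r addr0; split=> //; apply: Gb.
    move=> q /(psubP H0 HD)[[z w] [b [zH [e1 e2]]]].
    have bJ : (- b : R^o) \in smem J.
      apply/(@psubP _ R^o _ J0 JD); exists w; rewrite (_ : (- b : R) *: n = z) //.
      by apply/eqP; rewrite scaleNr eq_sym -addr_eq0 -e1.
    have hb := hP (Smod bJ); rewrite /= eP /= in hb.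
    have ez : z = - b *: n by apply/eqP; rewrite scaleNr -addr_eq0 -e1.
    rewrite -ez in hb.
    by rewrite e2 (Gfun _ _ _ zH hb) -scalerDl addNr scale0r.
  have eH : exist _ H' H'ok = G.
    apply: Gmax; apply/asboolP => x xH /=; apply/(psubP H0 HD).
    by exists x, 0; rewrite scale0r addr0.
  exists e; rewrite /H -eH /=; apply/(psubP H0 HD); exists 0, 1.
  by rewrite rpred0 scale1r add0r.
have [|||h hP] := @linear_of_relation R N Q (fun n q => (n, q) \in smem H).
- exact: Gtot.
- exact: G0.
- by move=> a x x' y y' h h'; rewrite (_ : (_, _) = a *: (x, y) + (x', y')) // rpredD ?rpredZ.
exists h => x; apply: (Gfun _ _ _ (hP _)); apply: Gb.
exact: (mem_im (lpair g f) (subfullP x)).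
Qed.

End Baer.

Section FinGen.
Variable R : pzRingType.
Implicit Types M N Q X : lmodType R.

Lemma fg_surj M N (f : {linear M -> N}) : surjective_map f ->
  finitely_generated M -> finitely_generated N.
Proof.
move=> fS [n [g gP]]; exists n, (fun i => f (g i)) => y.
have [x <-] := fS y; have [c ->] := gP x; exists c.
by rewrite linear_sum; apply: eq_bigr => i _; rewrite linearZ.
Qed.

Lemma fg_prod M N : finitely_generated M -> finitely_generated N ->
  finitely_generated (M * N)%type.
Proof.
move=> [m [g gP]] [n [h hP]]; exists (m + n)%N.
exists (fun i => match split i with inl j => (g j, 0) | inr j => (0, h j) end).
move=> [x y]; have [c ->] := gP x; have [d ->] := hP y.
exists (fun i => match split i with inl j => c j | inr j => d j end).
rewrite big_split_ord /=.
rewrite (eq_bigr (fun i => lpair (lid M) (lzero M N) (c i *: g i))); last first.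
  by move=> i _; rewrite (unsplitK (inl i)) linearZ.
rewrite -linear_sum [X in _ + X](eq_bigr (fun i => lpair (lzero N M) (lid N) (d i *: h i))); last first.
  by move=> i _; rewrite (unsplitK (inr i)) linearZ.
by rewrite -linear_sum; congr pair; rewrite /= ?addr0 ?add0r.
Qed.

Lemma fg_regular : finitely_generated (R^o : lmodType R).
Proof.
exists 1%N, (fun=> 1) => x; exists (fun=> x).
by rewrite big_ord1 -[_ *: _]/(x * 1) mulr1.
Qed.

Lemma fg_zero M : zero_module M -> finitely_generated M.
Proof. by move=> M0; exists 0%N, (fun=> 0) => x; exists (fun=> 0); rewrite (M0 x) big_ord0. Qed.

(** Given [f : J -> Q], the pushout of [f] and of the inclusion of [J] in the
    regular module is finitely generated and contains [Q]; the image of [1]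
    under a retraction onto [Q] is the element required by Baer's criterion. *)
Lemma split_injective Q : finitely_generated Q ->
  (forall X (i : {linear Q -> X}), finitely_generated X -> injective i ->
     exists r : {linear X -> Q}, forall x, r (i x) = x) ->
  injective_module Q.
Proof.
move=> Qfg Qs; apply: baer_criterion => J f.
pose D := imsub (lpair f (lopp (incl J))) (subfull _).
pose i := lcomp (qproj D) (lpair (lid Q) (lzero Q R^o)).
have iI : injective i.
  apply/lin_inj => x /eqP; rewrite /= qproj_ker => /psubP[j _ [<- /eqP]].
  by rewrite oppr_eq0 => /eqP j0; rewrite (_ : j = 0) ?linear0 //; apply: smod_ext.
have [|r rP] := Qs _ i _ iI.
  exact: (fg_surj (@qproj_surj _ _ D) (fg_prod Qfg fg_regular)).
pose e : (Q * R^o)%type := (0, 1).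
exists (r (qproj D e)) => a; rewrite -[LHS]rP.
have -> : (mval a : R) *: r (qproj D e) = r (qproj D ((mval a : R) *: e)).
  by rewrite !linearZ.
rewrite -[i _]/(qproj D (f a, 0)).
congr (r _); apply/eqP; rewrite -subr_eq0 -linearB qproj_ker.
apply/psubP; exists a; rewrite ?subfullP //=; congr pair.
  by rewrite /= scaler0 subr0.
by rewrite /= -[(_ : R) *: (1 : R^o)]/(_ * 1) mulr1 sub0r.
Qed.

(** By dependent choice, a class without a minimal element would contain an
    infinite strictly decreasing chain. *)
Lemma artinian_min M (P : submod M -> Prop) : artinian M -> (exists U, P U) ->
  exists U, P U /\ forall V, P V -> sle V U -> V = U.
Proof.
move=> Mart [U0 PU0]; apply: contrapT => nmin.
have nx (U : {U | P U}) : exists V : {U | P U}, sle (proj1_sig V) (proj1_sig U) /\ proj1_sig V <> proj1_sig U.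
  apply: contrapT => nV; apply: nmin; exists (proj1_sig U); split; first exact: proj2_sig.
  by move=> V PV VU; apply: contrapT => nVU; apply: nV; exists (exist _ V PV).
have [f fP] := choice nx.
pose c n := proj1_sig (iter n f (exist _ U0 PU0)).
have [|n|m mP] := Mart (fun n => smem (c n)).
- by move=> n; apply: submodP.
- by have [h _] := fP (iter n f (exist _ U0 PU0)).
have [_] := fP (iter m f (exist _ U0 PU0)); apply; apply: submod_ext => x.
exact: (mP m.+1 (leqnSn m)).
Qed.

End FinGen.

(** * Decomposition into uniserial summands *)
Section Decomposition.
Variable R : pzRingType.
Implicit Types M N Q X Y S : lmodType R.

Record usummand M := USummand {
  us_mod : lmodType R;
  us_len : nat;
  us_uni : uniserial us_mod us_len;
  us_in : {linear us_mod -> M};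
  us_out : {linear M -> us_mod};
  us_outK : forall x, us_out (us_in x) = x }.

(** A family of uniserial summands whose projectors add up to the identity.
    This is weaker than a direct sum decomposition, as the projectors need not
    be orthogonal. *)
Definition usum M := exists n (F : 'I_n -> usummand M),
  forall x, x = \sum_(i < n) us_in (F i) (us_out (F i) x).

Definition us_transport M N (s : {linear M -> N}) (r : {linear N -> M})
    (rs : forall x, r (s x) = x) (t : usummand M) : usummand N.
apply: (@USummand N _ _ (us_uni t) (lcomp s (us_in t)) (lcomp (us_out t) r)).
by move=> x /=; rewrite rs us_outK.
Defined.

Lemma usum_cat M X Y (s : {linear X -> M}) (r : {linear M -> X})
    (s' : {linear Y -> M}) (r' : {linear M -> Y}) :
  (forall x, r (s x) = x) -> (forall y, r' (s' y) = y) ->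
  (forall z, z = s (r z) + s' (r' z)) -> usum X -> usum Y -> usum M.
Proof.
move=> rs rs' dec [m [F FP]] [n [G GP]]; exists (m + n)%N.
exists (fun i => match split i with inl j => us_transport rs (F j)
                            | inr j => us_transport rs' (G j) end) => z.
rewrite big_split_ord /= [LHS]dec; congr (_ + _).
  rewrite [X in s X]FP linear_sum; apply: eq_bigr => i _.
  by rewrite (unsplitK (inl i)).
rewrite [X in s' X]GP linear_sum; apply: eq_bigr => i _.
by rewrite (unsplitK (inr i)).
Qed.

Lemma usum_iso M N : iso M N -> usum M -> usum N.
Proof.
move=> [f [g [fg gf]]] [n [F FP]]; exists n, (fun i => us_transport fg (F i)) => x.
by rewrite -[LHS]gf [X in f X]FP linear_sum.
Qed.

Lemma usum_uniserial M n : uniserial M n -> usum M.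
Proof.
move=> h; exists 1%N, (fun=> @USummand M M n h (lid M) (lid M) (fun=> erefl)) => x.
by rewrite big_ord1.
Qed.

Lemma iso_sub_im M (U : submod M) (V : submod (smod U)) :
  iso (smod V) (smod (imsub (incl U) V)).
Proof.
have [h hP] : exists h : {linear smod V -> smod (imsub (incl U) V)},
    forall x, incl _ (h x) = lcomp (incl U) (incl V) x.
  apply: factor_inj; first exact: smod_ext.
  move=> x; have xi : mval (mval x) \in smem (imsub (incl U) V).
    exact/mem_im/mvalP.
  by exists (Smod xi).
apply: (bij_iso (f := h)).
  move=> x y /(congr1 (incl _)); rewrite !hP /= => e.
  by apply/smod_ext/smod_ext.
move=> [y yP]; have /psubP[x xV xy] := yP.
by exists (Smod xV); apply: smod_ext; rewrite -[LHS]/(incl _ _) hP.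
Qed.

Lemma iso_full M : iso (smod (subfull M)) M.
Proof.
apply: (bij_iso (f := incl _)); first exact: smod_ext.
by move=> x; exists (Smod (subfullP x)).
Qed.

Lemma direct_proj M (U V : submod M) :
  (forall x, x \in smem U -> x \in smem V -> x = 0) ->
  (forall x, exists u v, [/\ u \in smem U, v \in smem V & x = u + v]) ->
  exists r : {linear M -> smod U}, (forall x, x - mval (r x) \in smem V) /\
   (forall x, r (incl U x) = x).
Proof.
move=> UV dec.
have [|||r rP] := @linear_of_relation R M (smod U) (fun x u => x - mval u \in smem V).
- move=> x; have [u [v [uU vV ->]]] := dec x.
  by exists (Smod uU); rewrite /= addrAC subrr add0r.
- move=> u; rewrite sub0r rpredN => uV; apply: smod_ext; rewrite linear0.
  by apply: UV => //; apply: mvalP.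
- move=> a x x' y y' h h'.
  have -> : mval (a *: y + y') = a *: mval y + mval y' by rewrite linearP.
  by rewrite opprD addrACA -scalerBr rpredD ?rpredZ.
exists r; split=> // u; apply: smod_ext; apply/eqP; rewrite eq_sym -subr_eq0.
by apply/eqP/UV; rewrite ?rP // rpredB ?mvalP.
Qed.

Hypothesis art : forall M, finitely_generated M -> artinian M.
Hypothesis nak : forall M, finitely_generated M -> indecomposable M -> serial M.

(** A minimal submodule among the finitely generated ones that do not decompose
    is neither indecomposable nor a sum of two smaller ones. *)
Lemma fg_usum M : finitely_generated M -> usum M.
Proof.
move=> Mfg; apply: contrapT => Mbad.
pose bad (U : submod M) := finitely_generated (smod U) /\ ~ usum (smod U).
have [|U [[Ufg Ubad] Umin]] := artinian_min (P := bad) (art Mfg).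
  exists (subfull M); split; last by move/(usum_iso (iso_full M)).
  have [f [g [fg gf]]] := iso_full M; apply: (fg_surj (f := g)) Mfg.
  by move=> x; exists (f x); rewrite fg.
have part (V W : submod (smod U)) :
    (forall x, x \in smem V -> x \in smem W -> x = 0) ->
    (forall x, exists u v, [/\ u \in smem V, v \in smem W & x = u + v]) ->
    W <> subzero _ -> usum (smod V).
  move=> VW dec W0; have [r [rP rK]] := direct_proj VW dec.
  apply: contrapT => Vbad.
  have Vfg : finitely_generated (smod V).
    by apply: (fg_surj (f := r)) => // x; exists (incl V x).
  have iV := iso_sub_im V.
  have VbadM : bad (imsub (incl U) V).
    split; last by move/(usum_iso (iso_sym iV)).
    have [f [g [fg gf]]] := iV; apply: (fg_surj (f := f)) Vfg.
    by move=> x; exists (g x).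
  have eV := Umin _ VbadM; apply: W0; apply: sle_anti; last exact: sub0le.
  move=> w wW; apply/psubP/VW => //.
  have : mval w \in smem (imsub (incl U) V).
    by rewrite eV ?mvalP // => x /psubP[v _ <-]; apply: mvalP.
  by move=> /psubP[v vV /smod_ext <-].
case: (pselect (indecomposable (smod U))) => [/(nak Ufg)/serial_uniserial[n]|].
  by move/usum_uniserial.
apply; split.
  move=> U0; apply: Ubad; exists 0%N, (fun i : 'I_0 => match notF (ltn_ord i) with end).
  by move=> x; rewrite big_ord0 (U0 x).
move=> V W Vc Wc VW dec; apply: contrapT => nVW.
pose V' := Submod Vc; pose W' := Submod Wc.
have V0 : V' <> subzero _.
  move=> e; apply: nVW; left=> x; rewrite -[x \in V]/(x \in smem V') e.
  by apply/psubP/idP => [->|/eqP]; rewrite ?inE.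
have W0 : W' <> subzero _.
  move=> e; apply: nVW; right=> x; rewrite -[x \in W]/(x \in smem W') e.
  by apply/psubP/idP => [->|/eqP]; rewrite ?inE.
have WV x : x \in smem W' -> x \in smem V' -> x = 0 by move=> h k; apply: VW.
have dec' x : exists u v, [/\ u \in smem W', v \in smem V' & x = u + v].
  by have [u [v [uV vW e]]] := dec x; exists v, u; rewrite addrC.
have [r [rP rK]] := direct_proj (U := V') (V := W') VW dec.
have [r' [rP' rK']] := direct_proj WV dec'.
apply: Ubad; apply: (usum_cat rK rK' _ (part V' W' VW dec W0) (part W' V' WV dec' V0)).
move=> z; apply/eqP; rewrite -subr_eq0 opprD addrA; apply/eqP.
have zW : z - incl V' (r z) - incl W' (r' z) \in smem W' by rewrite rpredB ?rP // mvalP.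
apply: VW zW; rewrite -[_ \in V]/(_ \in smem V').
by rewrite addrAC rpredB ?rP' // mvalP.
Qed.

(** [M] is a retract of the product of its summands. *)
Lemma usum_pdle M n : usum M ->
  (forall t : usummand M, pdle n (us_mod t)) -> pdle n M.
Proof.
move=> [m [F FP]] h.
have [Z [a [b [Zn ab]]]] : exists (Z : lmodType R) (a : {linear M -> Z}) (b : {linear Z -> M}),
    pdle n Z /\ forall x, b (a x) = \sum_(i <- enum 'I_m) us_in (F i) (us_out (F i) x).
  elim: (enum 'I_m) => [|i s [Z [a [b [Zn ab]]]]].
    exists (mod0 R), (lzero _ _), (lzero _ _); split.
      exact/projective_pdle/projective0/mod0P.
    by move=> x; rewrite big_nil.
  exists (us_mod (F i) * Z)%type, (lpair (us_out (F i)) a),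
    (ladd (lcomp (us_in (F i)) (lfst _ _)) (lcomp b (lsnd _ _))); split.
    exact: (pdle_mid (ses_prod _ _) (h _)).
  by move=> x; rewrite big_cons /= ab.
apply: retract_pdle Zn; exists a, b => x.
by rewrite ab [RHS]FP big_enum.
Qed.

End Decomposition.

(** Any choice [g] of an edge from each vertex of [X] to [X] is an injective,
    hence bijective, map of [X]; this gives the first claim.  For the second,
    redirect [g] at [s] to [t]: the new map is still onto, so it reaches [t'], and
    only from [s]. *)
Lemma indegree_count (F : finType) (X : {set F}) (E : F -> F -> Prop) :
  (forall s, s \in X -> exists2 t, t \in X & E s t) ->
  (forall s s' t, E s t -> E s' t -> s = s') ->
  (forall t, t \in X -> exists2 s, s \in X & E s t) /\
  (forall s t t', s \in X -> t \in X -> t' \in X -> E s t -> E s t' -> t = t').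
Proof.
move=> Eex Euniq.
have onto (g : F -> F) : (forall s, s \in X -> g s \in X /\ E s (g s)) ->
    forall t, t \in X -> exists2 s, s \in X & g s = t.
  move=> gP t tX; have gI : {in X &, injective g}.
    move=> s s' /gP[_ h] /gP[_ k] e; apply: Euniq h _; by rewrite e.
  have gX : g @: X \subset X by apply/subsetP => _ /imsetP[s /gP[sX _] ->].
  have : t \in g @: X.
    by have /eqP -> : g @: X == X by rewrite eqEcard gX (card_in_imset gI) leqnn.
  by case/imsetP => s sX ->; exists s.
have [|g gP] := @choice F F (fun s t => s \in X -> t \in X /\ E s t).
  move=> s; case: (boolP (s \in X)) => [/Eex[t tX Est]|]; first by exists t.
  by move=> _; exists s.
split.
  by move=> t /(onto g gP)[s sX <-]; exists s => //; have [] := gP s sX.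
move=> s t t' sX tX t'X Est Est'.
pose g' u := if u == s then t else g u.
have [|u uX] := onto g' _ t' t'X.
  by move=> u uX; rewrite /g'; case: eqP => [->|_] //; apply: gP.
rewrite /g'; case: eqP => // us gut'.
case: us; apply: Euniq Est'; rewrite -gut'.
by have [] := gP u uX.
Qed.

(** * Lifting and extending maps *)
Section Lifting.
Variable R : pzRingType.
Implicit Types M N P I J K X Y S T : lmodType R.

Lemma regular_projective : projective (R^o : lmodType R).
Proof.
move=> M N g f gS; have [m gm] := gS (f 1).
have hL : linear (fun a : R^o => (a : R) *: m).
  by move=> a x y; rewrite scalerDl -scalerA.
exists (mklin hL) => x; rewrite /= linearZ gm -linearZ; congr (f _).
by rewrite -[_ *: _]/((x : R) * 1) mulr1.
Qed.

Lemma usummand_projective (t : usummand (R^o : lmodType R)) : projective (us_mod t).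
Proof.
apply: retract_projective regular_projective.
by exists (us_in t), (us_out t); apply: us_outK.
Qed.

Lemma projective_lift P X Y (g : {linear X -> Y}) (f : {linear P -> Y}) :
  projective P -> (forall p, exists x, g x = f p) ->
  exists h : {linear P -> X}, forall p, g (h p) = f p.
Proof.
move=> PP gf.
have [g' g'P] : exists g' : {linear X -> smod (imsub g (subfull X))},
    forall x, incl _ (g' x) = g x.
  apply: factor_inj; first exact: smod_ext.
  by move=> x; exists (Smod (mem_im g (subfullP x))).
have [f' f'P] : exists f' : {linear P -> smod (imsub g (subfull X))},
    forall x, incl _ (f' x) = f x.
  apply: factor_inj; first exact: smod_ext.
  move=> p; have [x gx] := gf p.
  have fp : f p \in smem (imsub g (subfull X)) by rewrite -gx; apply/mem_im/subfullP.
  by exists (Smod fp).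
have [|h hP] := PP _ _ g' f'.
  move=> [y yP]; have /psubP[x _ xy] := yP; exists x; apply: smod_ext.
  by rewrite -[LHS]/(incl _ _) g'P.
by exists h => p; rewrite -g'P hP f'P.
Qed.

Lemma injective_extend I M N (g : {linear M -> N}) (f : {linear M -> I}) :
  injective_module I -> (forall x, g x = 0 -> f x = 0) ->
  exists h : {linear N -> I}, forall x, h (g x) = f x.
Proof.
move=> II gf.
have [g' g'P] : exists g' : {linear M -> smod (imsub g (subfull M))},
    forall x, incl _ (g' x) = g x.
  apply: factor_inj; first exact: smod_ext.
  by move=> x; exists (Smod (mem_im g (subfullP x))).
have g'S : surjective_map g'.
  move=> [y yP]; have /psubP[x _ xy] := yP; exists x; apply: smod_ext.
  by rewrite -[LHS]/(incl _ _) g'P.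
have [|f' f'P] := factor_surj (h := f) g'S.
  by move=> x g'x; apply: gf; rewrite -g'P g'x linear0.
have [h hP] := II _ _ (incl _) f' (@smod_ext _ _ _).
by exists h => x; rewrite -g'P hP f'P.
Qed.

(** Any element outside the maximal submodule is a generator. *)
Lemma uniserial_fg M n : uniserial M n -> finitely_generated M.
Proof.
move=> h; case: (pselect (zero_module M)) => [|M0]; first exact: fg_zero.
have [V [Vn Vm]] := max_sub h M0.
have [x _ xV] : exists2 x, x \in smem (subfull M) & x \notin smem V.
  by apply: not_sle => le; apply: Vn; apply: sle_anti => //; apply: lefull.
have hL : linear (fun a : R^o => (a : R) *: x).
  by move=> a y z; rewrite scalerDl -scalerA.
apply: (fg_surj (f := mklin hL)) (fg_regular R); apply: im_full_surj.
apply: contrapT => /Vm le; move/negP: xV; apply; apply: le.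
by have := mem_im (mklin hL) (subfullP (1 : R^o)); rewrite /= scale1r.
Qed.

(** The image of [i] is the socle, which lies in every nonzero kernel. *)
Lemma uniserial_ess M n S N (i : {linear S -> M}) (g : {linear M -> N}) s :
  uniserial M n -> simple_module S -> g (i s) <> 0 -> injective g.
Proof.
move=> h /simpleP[S0 hS] gis; apply: ker_trivial_inj; apply: contrapT => k0.
have i0 : imsub i (subfull S) <> subzero M.
  move=> e; apply: gis; have := mem_im i (subfullP s).
  by rewrite e => /psubP ->; rewrite linear0.
apply: i0; apply: (uniserial_cap h _ k0) => y /mem_kersub gy /psubP[x _ ex].
case: (hS (kersub (lcomp g i))) => e.
  have : x \in smem (kersub (lcomp g i)) by apply/mem_kersub; rewrite /= ex.
  by rewrite e => /psubP x0; rewrite -ex x0 linear0.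
case: gis; apply: ((mem_kersub (lcomp g i) s).1 _).
by rewrite e subfullP.
Qed.

Lemma simple_ex S : simple_module S -> exists s : S, s <> 0.
Proof. by case=> S0 _; apply: nonzero_ex. Qed.

(** Both kernels are the maximal submodule of [P]. *)
Lemma simple_quot_iso P n S S' (f : {linear P -> S}) (f' : {linear P -> S'}) :
  uniserial P n -> simple_module S -> simple_module S' ->
  surjective_map f -> surjective_map f' -> iso S S'.
Proof.
move=> h Ss Ss' fS f'S.
have [k1 k2] := simple_ker Ss fS; have [k1' k2'] := simple_ker Ss' f'S.
have e : kersub f = kersub f'.
  case: (uniserial_total h (kersub f) (kersub f')) => le; apply: contrapT => ne.
    by case: k1'; apply: k2 le _ => e; apply: ne.
  by case: k1; apply: k2' le _.
have [|g gP] := factor_surj (h := f') fS.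
  by move=> x /mem_kersub; rewrite e => /mem_kersub.
have [s s0] := simple_ex Ss'; have [x fx] := f'S s.
by apply: (simple_iso (f := g) (x := f x)) => //; rewrite gP fx.
Qed.

Lemma socle_simple M (W : submod M) : W <> subzero M ->
  (forall V, V <> subzero M -> sle W V) -> simple_module (smod W).
Proof.
move=> W0 Wm; apply/simpleP; split.
  move=> z; have [x xW x0] := subzero_nle W0.
  by apply: x0; have /(congr1 (@mval _ _ _)) := z (Smod xW); rewrite linear0.
move=> U; case: (pselect (U = subzero _)) => U0; [by left|right].
apply: sle_anti; first exact: lefull.
move=> x _; have : mval x \in smem (imsub (incl W) U).
  apply: Wm; last exact: mvalP.
  move=> e; apply: U0; apply: sle_anti; last exact: sub0le.
  move=> y yU; apply/psubP; apply: smod_ext; rewrite linear0.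
  by have := mem_im (incl W) yU; rewrite e => /psubP.
by move/psubP => [y yU /smod_ext <-].
Qed.

(** Take for [W] the smallest submodule of infinite projective dimension: its
    predecessor [V] in the chain has finite dimension, so [W / V] has not. *)
Lemma infinite_pd_factor M n (K : submod M) : uniserial M n -> ~ fpd (smod K) ->
  exists (W : submod M) (T : lmodType R) (t : {linear smod W -> T}),
    [/\ sle W K, simple_module T, surjective_map t & ~ fpd T].
Proof.
move=> h Kinf; have [U [Uall Ule]] := h.
have [k kn ek] := Uall K.
have Pex : exists i, (i <= n)%N && `[< ~ fpd (smod (U i)) >].
  by exists k; rewrite kn; apply/asboolP; rewrite -ek.
have [i /andP[ilt /asboolP Wi] imin] := ex_minnP Pex.
have ki : (i <= k)%N by apply: imin; rewrite kn; apply/asboolP; rewrite -ek.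
set W := U i in Wi.
have W0 : W <> subzero M.
  move=> e; apply: Wi; rewrite e; exists 0%N; apply: projective0 => x.
  by apply: smod_ext; have /psubP -> := mvalP x; rewrite linear0.
have [V [VW VnW Vm]] := pred_sub h W0.
have Vfin : fpd (smod V).
  have [j jn ej] := Uall V; apply: contrapT => Vinf.
  have ij : (i <= j)%N by apply: imin; rewrite jn; apply/asboolP; rewrite -ej.
  by apply: VnW; apply: sle_anti => //; rewrite ej; apply/Ule.
pose V' := presub (incl W) V.
have V'im : imsub (incl W) V' = V.
  apply: sle_anti => x; first by move/psubP => [y /psubP yV <-].
  move=> xV; apply/psubP; exists (Smod (VW x xV)) => //.
  exact/psubP.
have V'fin : fpd (smod V').
  case: Vfin => m Vm'; exists m; apply: iso_pdle Vm'.
  by apply: iso_sym; rewrite -[in X in iso _ X]V'im; apply: iso_sub_im.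
exists W, (qmod V'), (qproj V'); split.
- by rewrite ek; apply/Ule.
- have ker : kersub (qproj V') = V'.
    apply: submod_ext => x; apply/idP/idP.
      by move/mem_kersub/eqP; rewrite qproj_ker.
    by move=> xV; apply/mem_kersub/eqP; rewrite qproj_ker.
  apply: (simple_surj (f := qproj V')); first exact: qproj_surj.
    rewrite ker => e; apply: VnW; rewrite -V'im e; apply: sle_anti => x.
      by move/psubP => [y _ <-]; apply: mvalP.
    by move=> xW; apply/psubP; exists (Smod xW) => //; apply: subfullP.
  rewrite ker => Z _ Zn z zZ; apply/psubP.
  apply: (Vm (imsub (incl W) Z)); last exact: mem_im.
    by move=> x /psubP[y _ <-]; apply: mvalP.
  move=> e; apply: Zn; apply: sle_anti; first exact: lefull.
  move=> x _; have : mval x \in smem (imsub (incl W) Z) by rewrite e mvalP.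
  by move/psubP => [y yZ /smod_ext <-].
- exact: qproj_surj.
- by move=> Tfin; apply: Wi; apply: fpd_mid (ses_quo V') V'fin Tfin.
Qed.

End Lifting.

(** * Covers and injective hulls over a Nakayama algebra *)
Section Nakayama.
Variable R : pzRingType.
Implicit Types M N P I J K X Y S T : lmodType R.
Hypothesis art : forall M, finitely_generated M -> artinian M.
Hypothesis nak : forall M, finitely_generated M -> indecomposable M -> serial M.

(** If [x] lies outside the maximal submodule of [M], so does [a *: x] for the
    component [a] of [1] in some summand of the regular module; that summand
    then maps onto [M]. *)
Lemma cover_family : exists n (F : 'I_n -> usummand (R^o : lmodType R)),
  forall M m, uniserial M m -> ~ zero_module M ->
  exists i (f : {linear us_mod (F i) -> M}), surjective_map f.
Proof.
have [n [F FP]] := fg_usum art nak (fg_regular R); exists n, F => M m h M0.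
have [V [Vn Vm]] := max_sub h M0.
have [x _ xV] : exists2 x, x \in smem (subfull M) & x \notin smem V.
  by apply: not_sle => le; apply: Vn; apply: sle_anti => //; apply: lefull.
have hL : linear (fun a : R^o => (a : R) *: x).
  by move=> a y z; rewrite scalerDl -scalerA.
pose phi := mklin hL.
have [i iV] : exists i, phi (us_in (F i) (us_out (F i) 1)) \notin smem V.
  apply: contrapT => nex; move/negP: xV; apply.
  have -> : x = phi 1 by rewrite /= scale1r.
  rewrite [X in phi X]FP linear_sum rpred_sum // => i _.
  by apply: contrapT => /negP iV; apply: nex; exists i.
exists i, (lcomp phi (us_in (F i))); apply: im_full_surj.
apply: contrapT => /Vm le; move/negP: iV; apply; apply: le.
exact: (mem_im (lcomp phi (us_in (F i))) (subfullP _)).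
Qed.

Lemma uniserial_cover M m : uniserial M m -> ~ zero_module M ->
  exists P n (f : {linear P -> M}),
  [/\ uniserial P n, projective P & surjective_map f].
Proof.
have [n [F FP]] := cover_family => h M0; have [i [f fS]] := FP M m h M0.
exists (us_mod (F i)), (us_len (F i)), f; split => //; first exact: us_uni.
exact: usummand_projective.
Qed.

(** A uniserial module is no longer than a summand of the regular module that
    maps onto it. *)
Lemma length_bound : exists B, forall M m, uniserial M m -> (m <= B)%N.
Proof.
have [n [F FP]] := cover_family; exists (\max_i us_len (F i)) => M m h.
case: (pselect (zero_module M)) => [M0|/(FP M m h)[i [f fS]]].
  case: m h => // m [U [_ Ule]]; have : (1 <= 0)%N.
    by apply/Ule => // x _; rewrite (M0 x) rpred0.
  by [].
apply: leq_trans (leq_bigmax i).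
have [m' [m'n Mm' _]] := uniserial_surj fS (us_uni (F i)).
by rewrite (uniserial_uniq h Mm').
Qed.

(** Let [I] be a uniserial module of maximal length with socle [S].  If [I] is
    contained in a finitely generated [X], some uniserial summand of [X] receives
    [S], hence [I], injectively; by maximality [I] is isomorphic to this summand,
    and so [I] splits off [X]. *)
Lemma simple_hull S : simple_module S -> exists I n (i : {linear S -> I}),
  [/\ uniserial I n, injective_module I & injective i].
Proof.
move=> Ss; have [B BP] := length_bound.
pose lengths n := `[< exists I (i : {linear S -> I}), uniserial I n /\ injective i >].
have gex : exists n, lengths n.
  exists 1%N; apply/asboolP; exists S, (lid S); split=> //.
  exact: simple_uniserial.
have gB n : lengths n -> (n <= B)%N by move/asboolP => [I [i [/BP]]].
have [n /asboolP[I [i [In iI]]] nmax] := ex_maxnP gex gB.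
exists I, n, i; split=> //.
apply: split_injective; first exact: uniserial_fg In.
move=> X j Xfg jI; have [m [F FP]] := fg_usum art nak Xfg.
have [s s0] := simple_ex Ss.
have [k kP] : exists k, us_out (F k) (j (i s)) <> 0.
  apply: contrapT => nex; apply: s0; apply/iI/jI.
  rewrite [LHS]FP !linear0 big1 // => k _.
  suff -> : us_out (F k) (j (i s)) = 0 by rewrite linear0.
  by apply: contrapT => h; apply: nex; exists k.
pose g := lcomp (us_out (F k)) j.
have gI : injective g by apply: (uniserial_ess (i := i) (s := s) In Ss).
have [m' [m'n Im' m'surj]] := uniserial_inj gI (us_uni (F k)).
have em := uniserial_uniq In Im'.
have le : (us_len (F k) <= n)%N.
  apply: nmax; apply/asboolP; exists (us_mod (F k)), (lcomp g i).
  split; first exact: us_uni.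
  by move=> x y /gI/iI.
have gS : surjective_map g.
  by apply: m'surj; apply/eqP; rewrite eqn_leq m'n -em.
have [g' g'P] := factor_inj (h := lid _) gI gS.
exists (lcomp g' (us_out (F k))) => x; apply: gI.
exact: (g'P (g x)).
Qed.

Lemma uniserial_hull M m : uniserial M m -> ~ zero_module M ->
  exists J n (j : {linear M -> J}),
  [/\ uniserial J n, injective_module J & injective j].
Proof.
move=> h M0; have [W [W0 Wm]] := socle h M0.
have Ws := socle_simple W0 Wm.
have [I [n [i [In II iI]]]] := simple_hull Ws.
have [j jP] := II _ _ (incl W) i (@smod_ext _ _ _).
exists I, n, j; split=> //.
have [s s0] := simple_ex Ws.
apply: (uniserial_ess (i := incl W) (s := s) h Ws); rewrite jP => e.
by apply: s0; apply: iI; rewrite e linear0.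
Qed.

Lemma hull_envelope S I n (i : {linear S -> I}) : simple_module S ->
  uniserial I n -> injective_module I -> injective i -> injective_envelope i.
Proof.
move=> Ss In II iI; split=> // U Uc U0.
have [s s0] := simple_ex Ss.
have qis : ~ injective (qproj (Submod Uc)).
  move=> qI; apply: U0 => x; apply/idP/idP; rewrite inE.
    move=> xU; apply/eqP/qI; rewrite linear0; apply/eqP.
    by rewrite qproj_ker.
  by move/eqP ->; exact: (proj1 Uc).
exists s => //; rewrite -[_ \in U]/(_ \in smem (Submod Uc)) -qproj_ker.
apply/eqP; apply: contrapT => h; apply: qis.
exact: (uniserial_ess In Ss h).
Qed.

(** The hull [I] embeds in any envelope [I'] and splits off; as [I'] is
    essential over [S], the complement is zero. *)
Lemma envelope_iso S I I' n (i : {linear S -> I}) (i' : {linear S -> I'}) :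
  simple_module S -> uniserial I n -> injective_module I -> injective i ->
  injective_envelope i' -> iso I I'.
Proof.
move=> Ss In II iI [I'I i'I ess].
have [f fP] := I'I _ _ i i' iI.
have [s s0] := simple_ex Ss.
have fI : injective f.
  apply: (uniserial_ess (i := i) (s := s) In Ss); rewrite fP => e.
  by apply: s0; apply: i'I; rewrite e linear0.
have [r rP] := II _ _ f (lid I) fI.
have rI : injective r.
  apply: ker_trivial_inj; apply: contrapT => k0.
  have [|x x0] := ess _ (submodP (kersub r)).
    move=> e; apply: k0; apply: submod_ext => y; rewrite e inE.
    by apply/eqP/psubP.
  rewrite -[_ \in _]/(i' x \in smem (kersub r)) => /mem_kersub.
  by rewrite -fP rP /= => ix; apply: x0; apply: iI; rewrite ix linear0.
apply: (bij_iso (f := f)) => // y; exists (r y); apply: rI.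
by rewrite rP.
Qed.

(** * The arrows between simple modules *)

(** Only [P] lies strictly above the image of [p], and [phi] does not vanish on
    [ker p].  Let [J] be the hull of [P] by [j].  Since [P'] is uniserial,
    [ker phi] lies in [ker p], so [j \o p] factors as [psi \o phi] with
    [psi : I -> J].  If [j P] is contained in [psi I], then [j] lifts to an embedding
    of [P] in [I], whose image meets [ker psi] in [0]; but [ker psi] is not [0], as it
    contains [phi k].  So [psi I] is strictly smaller than [j P], hence equal to
    [j (p P')] by maximality, that is to [psi (phi P')].  Therefore
    [I = phi P' + ker psi], and [phi] is onto because [I] is uniserial. *)
Lemma syzygy_hull P P' I n n' m (p : {linear P' -> P}) (phi : {linear P' -> I}) k x0 :
  uniserial P n -> projective P -> uniserial P' n' ->
  uniserial I m -> injective_module I ->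
  (forall V, sle (imsub p (subfull P')) V -> V <> imsub p (subfull P') ->
     V = subfull P) ->
  p x0 <> 0 -> p k = 0 -> phi k <> 0 ->
  surjective_map phi.
Proof.
move=> Pn PP P'n Im II pmax px0 pk phik.
have [J [l [j [Jl JI jI]]]] : exists J n (j : {linear P -> J}),
    [/\ uniserial J n, injective_module J & injective j].
  by apply: uniserial_hull Pn _ => z; apply: px0.
have kerphi x : phi x = 0 -> p x = 0.
  move=> phix; case: (uniserial_total P'n (kersub phi) (kersub p)) => le.
    by apply/mem_kersub/le/mem_kersub.
  by case: phik; apply/mem_kersub/le/mem_kersub.
have [psi psiP] : exists psi : {linear I -> J}, forall x, psi (phi x) = lcomp j p x.
  by apply: injective_extend => // x /kerphi /= ->; rewrite linear0.
have case1 : ~ sle (imsub j (subfull P)) (imsub psi (subfull I)).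
  move=> le; have [h hP] : exists h : {linear P -> I}, forall x, psi (h x) = j x.
    apply: projective_lift => // x.
    by have /le/psubP[y _ <-] := mem_im j (subfullP x); exists y.
  have k0 : kersub psi <> subzero I.
    move=> e; apply: phik; have : phi k \in smem (kersub psi).
      by apply/mem_kersub; rewrite psiP /= pk linear0.
    by rewrite e => /psubP.
  have : imsub h (subfull P) = subzero I.
    apply: (uniserial_cap Im _ k0) => y /mem_kersub psix /psubP[x _ ex].
    by move: psix; rewrite -ex hP -(linear0 j) => /jI ->; rewrite linear0.
  move=> e; have := mem_im h (subfullP (p x0)); rewrite e => /psubP hx.
  by apply: px0; apply: jI; rewrite -hP hx !linear0.
have le : sle (imsub psi (subfull I)) (imsub j (subfull P)).
  by case: (uniserial_total Jl (imsub psi (subfull I)) (imsub j (subfull P))).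
apply: im_full_surj; apply: contrapT => phin; apply: case1.
have e : presub j (imsub psi (subfull I)) = subfull P.
  apply: pmax.
    move=> _ /psubP[x _ <-]; apply/psubP; rewrite -[j _]/(lcomp j p x) -psiP.
    exact/mem_im/subfullP.
  move=> e; have kf : kersub psi = subfull I.
    apply: (uniserial_sum Im _ phin) => y.
    have /le/psubP[z _ jz] := mem_im psi (subfullP y).
    have : z \in smem (presub j (imsub psi (subfull I))).
      by apply/psubP; rewrite jz; apply/mem_im/subfullP.
    rewrite e => /psubP[x _ px]; exists (phi x), (y - phi x); split.
    - exact/mem_im/subfullP.
    - by apply/mem_kersub; rewrite linearB psiP /= px jz subrr.
    - by rewrite addrC subrK.
  apply: px0; apply: jI; rewrite linear0 -[LHS]/(lcomp j p x0) -psiP.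
  by apply/mem_kersub; rewrite kf subfullP.
move=> _ /psubP[x _ <-]; have : x \in smem (presub j (imsub psi (subfull I))).
  by rewrite e subfullP.
by move/psubP.
Qed.

(** The start [P1 -> P0 -> S] of a minimal projective resolution of a simple
    module that is not projective: [pr_nz] says that [rad P0], the image of
    [pr_d], is not zero. *)
Record presentation S := Presentation {
  pr_P0 : lmodType R; pr_P1 : lmodType R;
  pr_n0 : nat; pr_n1 : nat;
  pr_f : {linear pr_P0 -> S};
  pr_d : {linear pr_P1 -> pr_P0};
  pr_uni0 : uniserial pr_P0 pr_n0;
  pr_uni1 : uniserial pr_P1 pr_n1;
  pr_proj0 : projective pr_P0;
  pr_proj1 : projective pr_P1;
  pr_surj : surjective_map pr_f;
  pr_im : imsub pr_d (subfull pr_P1) = kersub pr_f;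
  pr_nz : exists x, pr_d x <> 0 }.

Arguments pr_proj0 [S] p.
Arguments pr_proj1 [S] p.
Arguments pr_surj [S] p.

Definition subfactor M (K : submod M) T :=
  exists (W : submod M) (t : {linear smod W -> T}), sle W K /\ surjective_map t.

(** [T] is a composition factor of the second syzygy of [S]. *)
Definition arrow S T := exists p : presentation S, subfactor (kersub (pr_d p)) T.

Lemma pr_max S (p : presentation S) : simple_module S ->
  forall V, sle (imsub (pr_d p) (subfull _)) V ->
    V <> imsub (pr_d p) (subfull _) -> V = subfull _.
Proof. by rewrite pr_im => Ss; have [_ h] := simple_ker Ss (pr_surj p). Qed.

(** The composite [W -> T -> I] extends to [P1] by injectivity and is onto by
    [syzygy_hull]. *)
Lemma presentation_hull S T (p : presentation S) (W : submod (pr_P1 p))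
    (t : {linear smod W -> T}) I m (i : {linear T -> I}) :
  simple_module S -> simple_module T -> sle W (kersub (pr_d p)) ->
  surjective_map t -> uniserial I m -> injective_module I -> injective i ->
  exists phi : {linear pr_P1 p -> I},
   [/\ surjective_map phi, forall w, phi (mval w) = i (t w)
     & exists2 w, w \in smem W & phi w <> 0].
Proof.
move=> Ss Ts WK tS Im II iI.
have [phi phiP] := II _ _ (incl W) (lcomp i t) (@smod_ext _ _ _).
have [s s0] := simple_ex Ts; have [w wP] := tS s.
have phiw : phi (mval w) <> 0.
  by rewrite -[mval w]/(incl W w) phiP /= wP => e; apply: s0; apply: iI; rewrite e linear0.
exists phi; split=> //; last by exists (mval w) => //; apply: mvalP.
have [x px] := pr_nz p.
have pw : pr_d p (mval w) = 0 by apply/mem_kersub/WK/mvalP.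
exact: (syzygy_hull (pr_uni0 p) (pr_proj0 p) (pr_uni1 p) Im II (@pr_max _ p Ss) px pw phiw).
Qed.

(** Let [S1] be the top of [P1], which is also the top of [rad P0].  The map
    [rad P0 -> S1 -> J] extends to [a : P0 -> J], and [a] identifies [S] with the
    layer of [J] that lies just above the socle [S1]. *)
Lemma presentation_top S (p : presentation S) S1 J l (eta : {linear pr_P1 p -> S1})
    (j : {linear S1 -> J}) :
  simple_module S -> simple_module S1 -> surjective_map eta ->
  uniserial J l -> injective_module J -> injective j ->
  exists a : {linear pr_P0 p -> J}, forall x, (exists s, j s = a x) <-> pr_f p x = 0.
Proof.
move=> Ss Ss1 etaS Jl JI jI.
have [e1 e2] := simple_ker Ss1 etaS.
have [x0 px0] := pr_nz p.
have kd x : pr_d p x = 0 -> eta x = 0.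
  move=> dx; case: (uniserial_total (pr_uni1 p) (kersub (pr_d p)) (kersub eta)) => le.
    by apply/mem_kersub/le/mem_kersub.
  case: (pselect (kersub (pr_d p) = kersub eta)) => e.
    by apply/mem_kersub; rewrite -e; apply/mem_kersub.
  by case: px0; apply/mem_kersub; rewrite (e2 _ le e) subfullP.
have [a aP] : exists a : {linear pr_P0 p -> J}, forall x, a (pr_d p x) = lcomp j eta x.
  by apply: injective_extend => // x /kd /= ->; rewrite linear0.
exists a => x; split=> [[s sx]|fx]; last first.
  have : x \in smem (kersub (pr_f p)) by apply/mem_kersub.
  by rewrite -pr_im => /psubP[y _ <-]; exists (eta y); rewrite aP.
have [k1 k2] := simple_ker Ss (pr_surj p).
apply: contrapT => fx.
have pf : presub a (imsub j (subfull S1)) = subfull _.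
  apply: k2.
    rewrite -pr_im => _ /psubP[y _ <-]; apply/psubP; rewrite aP.
    exact/mem_im/subfullP.
  move=> e; apply: fx; apply/mem_kersub; rewrite -e; apply/psubP.
  by rewrite -sx; apply/mem_im/subfullP.
have ka : kersub a = subfull _.
  apply: (uniserial_sum (pr_uni0 p) _ k1) => y.
  have : y \in smem (presub a (imsub j (subfull S1))) by rewrite pf subfullP.
  move=> /psubP/psubP[s1 _ js1]; have [z ez] := etaS s1.
  exists (pr_d p z), (y - pr_d p z); split.
  - by rewrite -pr_im; apply/mem_im/subfullP.
  - by apply/mem_kersub; rewrite linearB aP /= ez js1 subrr.
  - by rewrite addrC subrK.
have [s1 s10] := simple_ex Ss1; have [z ez] := etaS s1.
apply: s10; apply: jI; rewrite linear0 -ez -[LHS]/(lcomp j eta z) -aP.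
by apply/mem_kersub; rewrite ka subfullP.
Qed.

(** Both [S] and [S'] are the layer of [J] just above its socle: compare the
    images of [P0] in [J] and lift one cover to the other. *)
Lemma presentation_iso S S' (p : presentation S) (p' : presentation S') S1 J l
    (eta : {linear pr_P1 p -> S1}) (eta' : {linear pr_P1 p' -> S1})
    (j : {linear S1 -> J}) :
  simple_module S -> simple_module S' -> simple_module S1 ->
  surjective_map eta -> surjective_map eta' ->
  uniserial J l -> injective_module J -> injective j -> iso S S'.
Proof.
move=> Ss Ss' Ss1 etaS etaS' Jl JI jI.
have [a aP] := presentation_top Ss Ss1 etaS Jl JI jI.
have [a' aP'] := presentation_top Ss' Ss1 etaS' Jl JI jI.
have main : forall U U' (q : presentation U) (q' : presentation U')
    (b : {linear pr_P0 q -> J}) (b' : {linear pr_P0 q' -> J}),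
    simple_module U -> simple_module U' ->
    (forall x, (exists s, j s = b x) <-> pr_f q x = 0) ->
    (forall x, (exists s, j s = b' x) <-> pr_f q' x = 0) ->
    sle (imsub b (subfull _)) (imsub b' (subfull _)) -> iso U U'.
  move=> U U' q q' b b' Us Us' bP bP' le.
  have [h hP] : exists h : {linear pr_P0 q -> pr_P0 q'}, forall x, b' (h x) = b x.
    apply: projective_lift; first exact: (pr_proj0 q).
    by move=> x; have /le/psubP[y _ <-] := mem_im b (subfullP x); exists y.
  have hf x : pr_f q' (h x) = 0 <-> pr_f q x = 0 by rewrite -bP' -bP hP.
  have [|g gP] := factor_surj (h := lcomp (pr_f q') h) (pr_surj q).
    by move=> x /hf.
  have [s s0] := simple_ex Us; have [x fx] := pr_surj q s.
  apply: (simple_iso (f := g) (x := s)) => //.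
  by rewrite -fx gP /= => /hf; rewrite fx.
case: (uniserial_total Jl (imsub a (subfull _)) (imsub a' (subfull _))) => le.
  exact: main aP aP' le.
apply: iso_sym; exact: main aP' aP le.
Qed.

(** The hull [I] of [T] is a quotient of [P1] for both presentations, which hence
    have the same top, that of [I]. *)
Lemma arrow_indegree S S' T : simple_module S -> simple_module S' ->
  simple_module T -> arrow S T -> arrow S' T -> iso S S'.
Proof.
move=> Ss Ss' Ts [p [W [t [WK tS]]]] [p' [W' [t' [WK' tS']]]].
have [I [m [i [Im II iI]]]] := simple_hull Ts.
have [phi [phiS _ _]] := presentation_hull Ss Ts WK tS Im II iI.
have [phi' [phiS' _ _]] := presentation_hull Ss' Ts WK' tS' Im II iI.
have [s s0] := simple_ex Ts.
have I0 : ~ zero_module I by move=> z; apply: s0; apply: iI; rewrite (z (i s)) linear0.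
have [V [Vn Vm]] := max_sub Im I0.
have ker : kersub (qproj V) = V.
  apply: submod_ext => x; apply/idP/idP.
    by move/mem_kersub/eqP; rewrite qproj_ker.
  by move=> xV; apply/mem_kersub/eqP; rewrite qproj_ker.
have S1s : simple_module (qmod V).
  apply: (simple_surj (f := qproj V)); first exact: qproj_surj.
    by rewrite ker.
  by rewrite ker => V' _; apply: Vm.
have [J [l [j [Jl JI jI]]]] := simple_hull S1s.
exact: (presentation_iso Ss Ss' S1s (comp_surj phiS (qproj_surj (U := V)))
  (comp_surj phiS' (qproj_surj (U := V))) Jl JI jI).
Qed.

(** The second syzygy of [S] has infinite projective dimension, so one of its
    composition factors has. *)
Lemma arrow_exists S : simple_module S -> ~ fpd S ->
  exists T, [/\ simple_module T, ~ fpd T & arrow S T].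
Proof.
move=> Ss Sinf; have Su := simple_uniserial Ss; have [S0 _] := Ss.
have [P [n [f [Pn PP fS]]]] := uniserial_cover Su S0.
pose Z := kersub f.
have Zinf : ~ fpd (smod Z).
  by move=> [k Zk]; apply: Sinf; exists k.+1; apply: pdle_ses (ses_ker fS) PP Zk.
have Z0 : ~ zero_module (smod Z).
  by move=> z; apply: Zinf; exists 0%N; apply: projective0.
have [k [_ Zk _]] := uniserial_inj (f := incl Z) (@smod_ext _ _ _) Pn.
have [P' [n' [r [P'n PP' rS]]]] := uniserial_cover Zk Z0.
pose d := lcomp (incl Z) r.
have dim : imsub d (subfull P') = kersub f.
  apply: sle_anti => x; first by move/psubP => [y _ <-]; apply: mvalP.
  move=> xZ; have [y yP] := rS (Smod xZ).
  by apply/psubP; exists y; rewrite ?subfullP //= yP.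
have dnz : exists x, d x <> 0.
  have [z z0] := nonzero_ex Z0; have [y yP] := rS z; exists y => /= dy.
  by apply: z0; apply: smod_ext; rewrite -yP; rewrite linear0.
pose p := Presentation Pn P'n PP PP' fS dim dnz.
have kr : kersub d = kersub r.
  apply: submod_ext => x; apply/idP/idP => /mem_kersub h; apply/mem_kersub.
    by apply: smod_ext; rewrite linear0.
  by rewrite /= h linear0.
have Kinf : ~ fpd (smod (kersub d)).
  rewrite kr => -[l Kl]; apply: Zinf; exists l.+1.
  exact: pdle_ses (ses_ker rS) PP' Kl.
have [W [T [t [WK Ts tS Tinf]]]] := infinite_pd_factor P'n Kinf.
by exists T; split=> //; exists p, W, t.
Qed.

(** A simple module is the top of one of finitely many uniserial summands of the
    regular module, and is classified by such a summand, chosen in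
    a way that depends only on the isomorphism class. *)
Lemma simple_classes : exists (F : finType) (c : lmodType R -> F),
  forall S S', simple_module S -> simple_module S' -> (c S = c S' <-> iso S S').
Proof.
have [n [F FP]] := cover_family.
have [|T TP] := @choice 'I_n (lmodType R) (fun i T => forall S, simple_module S ->
    (exists f : {linear us_mod (F i) -> S}, surjective_map f) -> iso S T).
  move=> i; case: (pselect (exists S, simple_module S /\
      (exists f : {linear us_mod (F i) -> S}, surjective_map f))).
    move=> [T [Ts [g gS]]]; exists T => S Ss [f fS].
    exact: (simple_quot_iso (us_uni (F i)) Ss Ts fS gS).
  by move=> nex; exists (mod0 R) => S Ss h; case: nex; exists S.
exists (option 'I_n), (fun S => [pick i | `[< iso S (T i) >]]) => S S' Ss Ss'; split.
  case: pickP => [i /asboolP Si|nS]; last first.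
    have [i [f fS]] := FP S 1%N (simple_uniserial Ss) (proj1 Ss).
    by have /negP[] := negbT (nS i); apply/asboolP/TP => //; exists f.
  case: pickP => // i' /asboolP Si' [ei]; rewrite -ei in Si'.
  exact: iso_trans Si (iso_sym Si').
move=> SS'; apply: eq_pick => i; apply/asboolP/asboolP.
  exact: iso_trans (iso_sym SS').
exact: iso_trans SS'.
Qed.

(** The counting argument of the introduction.  [V] is the kernel of
    [phi : P1 -> I], and [phi2] is the second map from [P1] onto [I], with a strictly
    smaller kernel.  The endomorphism [h] of [I] with [h \o phi2 = phi] is then onto
    but not injective, which the length of [I] forbids. *)
Lemma simple_or_hull_fpd S I m (i : {linear S -> I}) :
  simple_module S -> uniserial I m -> injective_module I -> injective i ->
  ~ fpd S -> fpd I.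
Proof.
move=> Ss Im II iI Sinf; apply: contrapT => Iinf.
have [F [c cP]] := simple_classes.
pose X := [set s | `[< exists T, [/\ simple_module T, ~ fpd T & c T = s] >]].
pose E s t := exists U T, [/\ simple_module U /\ ~ fpd U, simple_module T /\ ~ fpd T,
   arrow U T, c U = s & c T = t].
have XP T : simple_module T -> ~ fpd T -> c T \in X.
  by move=> Ts Tinf; rewrite inE; apply/asboolP; exists T.
have [||ex uniq] := @indegree_count F X E.
- move=> s; rewrite inE => /asboolP[U [Us Uinf <-]].
  have [T [Ts Tinf UT]] := arrow_exists Us Uinf.
  by exists (c T); [apply: XP|exists U, T].
- move=> s s' t [U [T [[Us _] [Ts _] UT <- <-]]] [U' [T' [[Us' _] [Ts' _] UT' <- /cP e]]].
  apply/cP => //; apply: (arrow_indegree Us Us' Ts UT).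
  have [u [v [uv vu]]] := e Ts' Ts.
  have [p [W [t' [WK tS]]]] := UT'; exists p, W, (lcomp u t'); split=> //.
  by apply: comp_surj => // x; exists (v x).
have [_ _ [U [S0 [[Us Uinf] [S0s S0inf] US0 _ /cP e]]]] := ex _ (XP S Ss Sinf).
have [u [v [uv vu]]] := e S0s Ss.
have [p [W [t0 [WK t0S]]]] := US0.
have tS : surjective_map (lcomp u t0) by apply: comp_surj => // x; exists (v x).
have [phi [phiS _ [w wW phiw]]] := presentation_hull Us Ss WK tS Im II iI.
have VK : sle (kersub phi) (kersub (pr_d p)).
  case: (uniserial_total (pr_uni1 p) (kersub phi) (kersub (pr_d p))) => // le.
  by case: phiw; apply/mem_kersub/le/WK.
have Vinf : ~ fpd (smod (kersub phi)).
  by move=> [k Vk]; apply: Iinf; exists k.+1; apply: (pdle_ses (ses_ker phiS) (pr_proj1 p) Vk).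
have [W2 [T [t2 [W2V Ts t2S Tinf]]]] := infinite_pd_factor (pr_uni1 p) Vinf.
have W2K := sle_trans W2V VK.
have UT : arrow U T by exists p, W2, t2.
have /cP TS : c T = c S.
  apply: (uniq (c U)); try exact: XP.
    by exists U, T.
  have US : arrow U S by exists p, W, (lcomp u t0).
  by exists U, S.
have [g [g' [gg' g'g]]] := TS Ts Ss.
have gS : surjective_map (lcomp g t2) by apply: comp_surj => // x; exists (g' x).
have [phi2 [phi2S _ [w2 w2W phiw2]]] := presentation_hull Us Ss W2K gS Im II iI.
have V2V : sle (kersub phi2) (kersub phi).
  case: (uniserial_total (pr_uni1 p) (kersub phi2) (kersub phi)) => // le.
  by case: phiw2; apply/mem_kersub/le/W2V.
have [|h hP] := factor_surj (h := phi) phi2S.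
  by move=> x phi2x; apply/mem_kersub/V2V/mem_kersub.
have hS : surjective_map h.
  by move=> y; have [x <-] := phiS y; exists (phi2 x).
have [m' [_ Im' inj]] := uniserial_surj hS Im.
apply: phiw2; apply: (inj (uniserial_uniq Im' Im)); rewrite hP linear0.
exact/mem_kersub/W2V.
Qed.

End Nakayama.

(** * The finitistic dimension *)
Section FinPro.
Variable R : pzRingType.
Implicit Types M N P I J K X Y Z S T : lmodType R.
Hypothesis art : forall M, finitely_generated M -> artinian M.
Hypothesis nak : forall M, finitely_generated M -> indecomposable M -> serial M.
Hypothesis R_nz : (1 : R) <> 0.

Lemma quo_ker_iso X Y (f : {linear X -> Y}) : surjective_map f ->
  iso (qmod (kersub f)) Y.
Proof.
move=> fS; have [|g gP] := factor_surj (h := f) (qproj_surj (U := kersub f)).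
  by move=> x /eqP; rewrite qproj_ker => /mem_kersub.
apply: (bij_iso (f := g)); last by move=> y; have [x <-] := fS y; exists (qproj _ x).
apply/lin_inj => x; have [z <-] := qproj_surj x; rewrite gP => fz.
by apply/eqP; rewrite qproj_ker; apply/mem_kersub.
Qed.

Lemma fpd_quo_bound P n : uniserial P n -> exists b, forall U : submod P,
  fpd (qmod U) -> pdle b (qmod U).
Proof.
move=> [U [Uall _]].
have [|b bP] := @choice nat nat (fun i b => fpd (qmod (U i)) -> pdle b (qmod (U i))).
  move=> i; case: (pselect (fpd (qmod (U i)))) => [[b h]|h]; first by exists b.
  by exists 0%N.
exists (\max_(i < n.+1) b i) => V; have [i ilt ->] := Uall V => /bP.
by apply: pdle_leq; rewrite -ltnS in ilt; exact: (leq_bigmax (Ordinal ilt)).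
Qed.

(** Every nonzero uniserial module is isomorphic to one of the finitely many
    quotients of the covering summands. *)
Lemma fpd_bound : exists b, forall M, finitely_generated M -> fpd M -> pdle b M.
Proof.
have [n [F FP]] := cover_family art nak.
have [|b bP] := @choice 'I_n nat (fun i b => forall U : submod (us_mod (F i)),
    fpd (qmod U) -> pdle b (qmod U)).
  by move=> i; exact: fpd_quo_bound (us_uni (F i)).
exists (\max_i b i) => M Mfg [k Mk]; apply: usum_pdle (fg_usum art nak Mfg) _ => t.
have tk : pdle k (us_mod t).
  by apply: retract_pdle Mk; exists (us_in t), (us_out t); apply: us_outK.
case: (pselect (zero_module (us_mod t))) => [z|nz].
  exact/projective_pdle/projective0.
have [i [f fS]] := FP _ _ (us_uni t) nz.
have e := quo_ker_iso fS; apply: (iso_pdle e); apply: pdle_leq (leq_bigmax i) _.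
by apply: bP; exists k; apply: iso_pdle tk; apply: iso_sym.
Qed.

Lemma fin_pro_spec : exists m, [/\ fin_pro R = Some m,
  forall M, finitely_generated M -> fpd M -> pdle m M &
  forall n, (forall M, finitely_generated M -> fpd M -> pdle n M) -> (m <= n)%N].
Proof.
rewrite /fin_pro /enat_sup /enat_least; case: pselect => [exP|nex].
  case: ex_minnP => m /asboolP mP mmin; exists m; split=> // [M Mfg Mfin|n nP].
    by apply/pd_leP/mP; exists M; split=> //; apply/pd_fin.
  apply: mmin; apply/asboolP => v [M [Mfg /pd_fin Mfin ->]].
  exact/pd_leP/nP.
case: nex; have [b bP] := fpd_bound; exists b; apply/asboolP => v [M [Mfg /pd_fin Mfin ->]].
exact/pd_leP/bP.
Qed.

Definition pd_ge m M := forall n, pdle n M -> (m <= n)%N.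

Lemma pd_geS m M : pd_ge m.+1 M <-> ~ pdle m M.
Proof.
split=> [h /h|h n Mn]; first by rewrite ltnn.
by rewrite ltnNge; apply/negP => nm; apply: h; apply: pdle_leq Mn.
Qed.

Lemma pd_quotient X Y Z (f : {linear X -> Y}) (g : {linear Y -> Z}) a m :
  ses f g -> (a < m)%N -> pdle a X -> pdle m Y -> pd_ge m Y ->
  pdle m Z /\ pd_ge m Z.
Proof.
case: m => // m fg; rewrite ltnS => am /(pdle_leq am) Xm Ym /pd_geS Yge.
split; first exact: pdle_right fg Xm Ym.
by apply/pd_geS => Zm; apply: Yge; apply: pdle_mid fg Xm Zm.
Qed.

Lemma pd_ge_middle X Y Z (f : {linear X -> Y}) (g : {linear Y -> Z}) m :
  ses f g -> pd_ge m X -> pdle m Z -> pd_ge m Y.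
Proof.
case: m => // m fg /pd_geS Xge Zm; apply/pd_geS => Ym.
by apply: Xge; apply: pdle_left fg Ym Zm.
Qed.

Lemma uniserial_nonzero_exists : exists P n, [/\ uniserial P n, projective P & ~ zero_module P].
Proof.
have [n [F FP]] := fg_usum art nak (fg_regular R).
have [i iP] : exists i, us_out (F i) 1 <> 0.
  apply: contrapT => nex; apply: R_nz; rewrite [LHS]FP big1 // => i _.
  suff -> : us_out (F i) 1 = 0 by rewrite linear0.
  by apply: contrapT => h; apply: nex; exists i.
exists (us_mod (F i)), (us_len (F i)); split; first exact: us_uni.
  exact: usummand_projective.
by move=> z; apply: iP; apply: z.
Qed.

(** Since [m.-1] is not an upper bound, some finitely generated module of finite
    projective dimension exceeds it, and so does one of its uniserial summands. *)
Lemma fin_pro_attained m :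
  (forall M, finitely_generated M -> fpd M -> pdle m M) ->
  (forall n, (forall M, finitely_generated M -> fpd M -> pdle n M) -> (m <= n)%N) ->
  exists M n, [/\ uniserial M n, ~ zero_module M, pdle m M & pd_ge m M].
Proof.
case: m => [|m] mub mmin.
  have [P [n [Pn PP P0]]] := uniserial_nonzero_exists.
  by exists P, n; split.
apply: contrapT => nex; have := mmin m; rewrite ltnn => h; suff: false by [].
apply: h => M Mfg [k Mk]; apply: usum_pdle (fg_usum art nak Mfg) _ => t.
apply: contrapT => tm; apply: nex; exists (us_mod t), (us_len t); split.
- exact: us_uni.
- by move=> z; apply: tm; apply/projective_pdle/projective0.
- apply: mub; first exact: uniserial_fg (us_uni t).
  by exists k; apply: retract_pdle Mk; exists (us_in t), (us_out t); apply: us_outK.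
- exact/pd_geS.
Qed.

(** Among the nonzero uniserial modules of dimension [m], one of least length has a socle
    [W] with [pd W >= m], since otherwise the quotient by [W] is a shorter one
    ([pd_quotient]).  The hull [I] of [W] contains [M], and if [pd I] is finite then so
    is [pd (I / M)], which is thus at most [m]; hence [pd I >= m]
    ([pd_ge_middle]). *)
Lemma simple_attains m :
  (forall M, finitely_generated M -> fpd M -> pdle m M) ->
  (exists M n, [/\ uniserial M n, ~ zero_module M, pdle m M & pd_ge m M]) ->
  exists S I n (i : {linear S -> I}),
    [/\ simple_module S, [/\ uniserial I n, injective_module I & injective i],
     pd_ge m S & pd_ge m I].
Proof.
move=> mub ex.
pose lengths n := `[< exists M, [/\ uniserial M n, ~ zero_module M, pdle m M & pd_ge m M] >].
have gex : exists n, lengths n.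
  by have [M [n h]] := ex; exists n; apply/asboolP; exists M.
have [l /asboolP[M [Ml M0 Mm Mge]] lmin] := ex_minnP gex.
have [W [W0 Wm]] := socle Ml M0.
have Ws := socle_simple W0 Wm.
have Wge : pd_ge m (smod W).
  move=> a Wa; rewrite leqNgt; apply/negP => am.
  have sW := ses_quo W.
  have [Qm Qge] := pd_quotient sW am Wa Mm Mge.
  have [l' [l'l Ql' inj]] := uniserial_surj (qproj_surj (U := W)) Ml.
  have ll' : (l <= l')%N.
    apply: lmin; apply/asboolP; exists (qmod W); split=> // Q0.
    by have := Qge 0%N (projective0 Q0); rewrite leqNgt (leq_ltn_trans _ am).
  have /inj qI : l' = l by apply/eqP; rewrite eqn_leq l'l.
  have [x xW x0] := subzero_nle W0; apply: x0; apply: qI; rewrite linear0.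
  by apply/eqP; rewrite qproj_ker.
have [I [n [i [In II iI]]]] := simple_hull art nak Ws.
exists (smod W), I, n, i; split=> //.
have [j jP] := II _ _ (incl W) i (@smod_ext _ _ _).
have [s s0] := simple_ex Ws.
have jI : injective j.
  apply: (uniserial_ess (i := incl W) (s := s) Ml Ws); rewrite jP => e.
  by apply: s0; apply: iI; rewrite e linear0.
pose q := qproj (imsub j (subfull M)).
have jq : ses j q.
  split=> //; first exact: qproj_surj.
  move=> y; split => [/eqP|[x <-]].
    by rewrite qproj_ker => /psubP[x _ <-]; exists x.
  by apply/eqP; rewrite qproj_ker; apply/mem_im/subfullP.
move=> a Ia; apply: (pd_ge_middle jq Mge _ Ia); apply: mub.
  by apply: (fg_surj (f := q)) (uniserial_fg In); exact: qproj_surj.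
by apply: fpd_right jq _ _; [exists m|exists a].
Qed.

Lemma pd_eq m M : pd_ge m M -> pdle m M -> pd M = Some m.
Proof.
move=> Mge /pd_leP; case e : (pd M) => [n|] //= nm; congr Some; apply/eqP.
by rewrite eqn_leq nm; apply: Mge; apply/pd_leP; rewrite e /= leqnn.
Qed.

Lemma pd_None M : ~ fpd M -> pd M = None.
Proof. by move=> h; apply: contrapT => /pd_fin. Qed.

Theorem fin_pro_max :
  is_max (fun v => exists S, simple_module S /\ e_value S v) (fin_pro R).
Proof.
have [m [-> mub mmin]] := fin_pro_spec; split.
  have [S [I [n [i [Ss [In II iI] Sge Ige]]]]] := simple_attains mub (fin_pro_attained mub mmin).
  exists S; split=> //; exists I, i; split; first exact: hull_envelope Ss In II iI.
  have pdv M : finitely_generated M -> pd_ge m M -> pd M = Some m \/ pd M = None.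
    move=> Mfg Mge; case: (pselect (fpd M)) => h; [left|right].
      by apply: pd_eq => //; apply: mub.
    exact: pd_None.
  have Sfg := uniserial_fg (simple_uniserial Ss); have Ifg := uniserial_fg In.
  case: (pselect (fpd S)) => h.
    rewrite (pd_eq Sge (mub S Sfg h)).
    by case: (pdv I Ifg Ige) => ->; rewrite /enat_min /= ?leqnn.
  rewrite (pd_None h) (pd_eq Ige) //; apply: mub => //.
  exact: (simple_or_hull_fpd art nak Ss In II iI h).
move=> v [S [Ss [I' [i' [env ->]]]]].
have [I [n [i [In II iI]]]] := simple_hull art nak Ss.
have II' := envelope_iso Ss In II iI env.
have I'n : uniserial I' n by apply: uniserial_iso In; apply: iso_sym.
have Sfg := uniserial_fg (simple_uniserial Ss); have I'fg := uniserial_fg I'n.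
case: (pselect (fpd S)) => h.
  have /pd_leP := mub S Sfg h; rewrite /enat_min.
  case: (pd S) => [a|] //= am; case: (pd I') => [b|] //=.
  by case: ifP => //= /negbT; rewrite -ltnNge => /ltnW ba; apply: leq_trans am.
have [k Ik] := simple_or_hull_fpd art nak Ss In II iI h.
have /pd_leP : pdle m I' by apply: mub => //; exists k; apply: iso_pdle Ik.
by rewrite (pd_None h) /enat_min; case: (pd I').
Qed.

End FinPro.

(** * Modules over an artin algebra *)
Section Artinian.
Variable R : pzRingType.

(** Induction on the number of generators [g' 0], [g' 1] and so on: a decreasing chain of
    submodules [U k] in the span of the first [N.+1] of them is stationary as
    soon as its traces on the span of the first [N], and the left ideals [J k] of
    the possible coefficients of [g' N], are. *)
Lemma artinian_fg (M : lmodType R) : artinian (R^o : lmodType R) ->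
  finitely_generated M -> artinian M.
Proof.
move=> Rart [n [g gP]].
pose g' (i : nat) := if insub i is Some j then g j else 0.
pose Sp N (x : M) := exists c : nat -> R, x = \sum_(i < N) c i *: g' i.
have SpD N a x y : Sp N x -> Sp N y -> Sp N (a *: x + y).
  move=> [c ->] [d ->]; exists (fun i => a * c i + d i).
  rewrite scaler_sumr -big_split; apply: eq_bigr => i _ /=.
  by rewrite scalerDl scalerA.
have Sp0 N : Sp N 0.
  by exists (fun=> 0); rewrite big1 // => i _; rewrite scale0r.
have SpB N x y : Sp N x -> Sp N y -> Sp N (x - y).
  by move=> hx hy; rewrite addrC -scaleN1r; apply: SpD.
have main N (U : nat -> submod M) : (forall k, sle (U k.+1) (U k)) ->
    (forall k x, x \in smem (U k) -> Sp N x) ->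
    exists m, forall k, (m <= k)%N -> sle (U m) (U k).
  elim: N U => [|N IH] U Udec USp.
    exists 0%N => k _ x /USp[c ->]; by rewrite big_ord0 rpred0.
  have mono a b : (a <= b)%N -> sle (U b) (U a).
    move/subnK <-; elim: (b - a)%N => // d IHd; exact: sle_trans (Udec _) IHd.
  pose J k (c : R) := exists2 x, x \in smem (U k) & Sp N (x - c *: g' N).
  have J0 k : J k 0 by exists 0; rewrite ?rpred0 // scale0r subr0.
  have JD k (a c d : R) : J k c -> J k d -> J k (a * c + d).
    move=> [x xU xS] [y yU yS]; exists (a *: x + y); first by rewrite rpredD ?rpredZ.
    rewrite scalerDl -scalerA opprD addrACA -scalerBr; exact: SpD.
  pose JS k := @psub R R^o (J k) (J0 k) (JD k).
  have [|k c|p pP] := Rart (fun k => smem (JS k)).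
  - by move=> k; apply: submodP.
  - by move/asboolP => [x xU xS]; apply/asboolP; exists x => //; apply: Udec.
  pose SpS := psub (Sp0 N) (SpD N).
  have [||q qP] := IH (fun k => subcap (U k) SpS).
  - by move=> k x /psubP[xU xS]; apply/psubP; split=> //; apply: Udec.
  - by move=> k x /psubP[_ /asboolP].
  exists (maxn p q) => k; rewrite geq_max => /andP[pk qk] x xU.
  have [c ex] := USp _ _ xU; rewrite big_ord_recr /= in ex.
  have Jc : (c N : R^o) \in smem (JS p).
    apply/asboolP; exists x; last by rewrite ex addrK; exists c.
    by apply: mono xU; apply: leq_maxl.
  rewrite -(pP k pk) in Jc; move/asboolP: Jc => [y yU yS].
  rewrite -(subrK y x) rpredD //.
  suff /(qP k qk)/psubP[] : x - y \in smem (subcap (U q) SpS) by [].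
  apply/psubP; split.
    rewrite rpredB //; first by apply: mono xU; apply: leq_maxr.
    by apply: mono yU.
  apply/asboolP; have -> : x - y = (x - c N *: g' N) - (y - c N *: g' N).
    by rewrite opprB addrA subrK.
  by apply: SpB => //; rewrite ex addrK; exists c.
move=> U Uc Udec.
have [||m mP] := main n (fun k => Submod (Uc k)).
- by move=> k; apply: Udec.
- move=> k x _; have [c ->] := gP x.
  exists (fun i => if insub i is Some j then c j else 0).
  apply: eq_bigr => i _; rewrite /g'; case: insubP => [j _ ij|]; last by rewrite ltn_ord.
  by have -> : j = i by apply: val_inj.
exists m => k mk x; apply/idP/idP; last exact: (mP k mk x).
have mono a b : (a <= b)%N -> {subset U b <= U a}.
  move/subnK <-; elim: (b - a)%N => // d IHd y /Udec; exact: IHd.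
exact: mono.
Qed.

Lemma fg_finType (M : lmodType R) (I : finType) (g : I -> M) :
  (forall x, exists c : I -> R, x = \sum_i c i *: g i) -> finitely_generated M.
Proof.
move=> gP; exists #|I|, (fun i => g (enum_val i)) => x.
have [c ->] := gP x; exists (fun i => c (enum_val i)).
exact: (reindex _ (onW_bij _ (enum_val_bij I))).
Qed.

End Artinian.

Section Restriction.
Variables (k : comNzRingType) (A : algType k).

(** [M] with scalars restricted to [k], to which [artinian_fg] applies. *)
Definition restr (M : lmodType A) : Type := M.

Section Instances.
Variable M : lmodType A.
HB.instance Definition _ := GRing.Zmodule.on (restr M).

Definition restr_scale (a : k) (x : restr M) : restr M := (a%:A : A) *: (x : M).

Fact restr_scaleA a b v : restr_scale a (restr_scale b v) = restr_scale (a * b) v.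
Proof. by rewrite /restr_scale scalerA mulr_algl scalerA. Qed.
Fact restr_scale1 : left_id 1 restr_scale.
Proof. by move=> v; rewrite /restr_scale scale1r scale1r. Qed.
Fact restr_scaleDr : right_distributive restr_scale +%R.
Proof. by move=> a x y; rewrite /restr_scale scalerDr. Qed.
Fact restr_scaleDl v : {morph restr_scale^~ v : a b / a + b}.
Proof. by move=> a b; rewrite /restr_scale !scalerDl. Qed.
HB.instance Definition _ := GRing.Zmodule_isLmodule.Build k (restr M)
  restr_scaleA restr_scale1 restr_scaleDr restr_scaleDl.
End Instances.

Lemma algebra_artinian (M : lmodType A) : artin_algebra A ->
  finitely_generated M -> artinian M.
Proof.
move=> [kart [m [a aP]]] [n [g gP]].
have rfg : finitely_generated (restr M : lmodType k).
  apply: (@fg_finType k (restr M) ('I_n * 'I_m)%type (fun p => a p.2 *: g p.1 : M)) => x.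
  have [c ->] := gP x.
  have [d dP] := choice (fun i => aP (c i)).
  exists (fun p => d p.1 p.2); rewrite -(pair_bigA _ (fun i j => (d i j) *: (a j *: g i : restr M))) /=.
  apply: eq_bigr => i _; rewrite [X in X *: _]dP scaler_suml; apply: eq_bigr => j _.
  by rewrite -[RHS]/((d i j)%:A *: (a j *: g i)) scalerA mulr_algl.
have rart := artinian_fg kart rfg.
move=> U Uc Udec; apply: (rart U) => // j; split; first exact: (proj1 (Uc j)).
by move=> c x y xU yU; apply: (proj2 (Uc j)).
Qed.

End Restriction.

Theorem mainTheorem6 (k : comNzRingType) (A : algType k) :
  nakayama_algebra A ->
  is_max (fun v : enat =>
            exists S : lmodType A, simple_module S /\ e_value S v)
         (fin_pro A).
Proof.
move=> [Aart nak]; apply: fin_pro_max => //.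
- by move=> M; apply: algebra_artinian.
- by move/eqP; rewrite oner_eq0.
Qed.
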